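(* Let $(N^3(c),h)$ be a three-dimensional Riemannian manifold of constant curvature $c$, let $\xi$ be a nonzero vector field on $N^3(c)$, and let $\gamma:I\to(N^3(c),h)$ be a curve parametrized by arc length, $I\subseteq\mathbb{R}$ an open interval, with Frenet frame $\{T,N,B\}$, geodesic curvature $k$ and geodesic torsion $\tau$. Write $\xi=\xi_1T+\xi_2N+\xi_3B$ along $\gamma$, put $X_1=T$, $X_2=N$, $X_3=B$, $\sigma_{ij}=h(X_i,\sigma(X_j))$ where $\sigma(X)=\nabla_X\xi$, and $$\alpha=\xi_1'-k\xi_2,\qquad \beta=\xi_2'+k\xi_1-\tau\xi_3,\qquad \delta=\xi_3'+\tau\xi_2.$$ Then $\gamma$ is generalized $\xi$-parallel if and only if the following three conditions hold on $I$: $$(\xi_1'-k\xi_2)^2+(\xi_2'+k\xi_1-\tau\xi_3)^2+(\xi_3'+\tau\xi_2)^2 \ \text{ is constant},$$ $$c\,(\xi_1'\xi_2-k\xi_2^2-\xi_1\xi_2'-k\xi_1^2+\tau\xi_1\xi_3)+(\alpha'-k\beta)\sigma_{12}+(k\alpha+\beta'-\tau\delta)\sigma_{22}+(\tau\beta+\delta')\sigma_{32}=0,$$ $$c\,(\xi_1'\xi_3-k\xi_2\xi_3-\xi_1\xi_3'-\tau\xi_1\xi_2)+(\alpha'-k\beta)\sigma_{13}+(k\alpha+\beta'-\tau\delta)\sigma_{23}+(\tau\beta+\delta')\sigma_{33}=0.$$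
   Context: $\nabla$ is the Levi-Civita connection of $(N^3(c),h)$; primes denote derivatives with respect to the arc-length parameter $t$. The Frenet frame $\{T,N,B\}$ is the orthonormal frame field along $\gamma$ with $T=d\gamma(\frac{d}{dt})$ the unit tangent vector, $N$ the unit normal vector in the direction of $\nabla_TT$, and $B$ chosen so that $\{T,N,B\}$ is positively oriented; it satisfies $\nabla_TT=kN$, $\nabla_TN=-kT+\tau B$, $\nabla_TB=-\tau N$. It is assumed that this frame is defined along $\gamma$. For a smooth map $\varphi:(M,g)\to(N,h)$ between Riemannian manifolds, a nonzero vector field $\xi$ on $N$, and a compact domain $D\subset M$, let $E_\xi(\varphi;D)=\frac12\int_D|\nabla^\varphi(\xi\circ\varphi)|^2v_g$, where $\nabla^\varphi$ is the pullback connection on $\varphi^{-1}TN$, $v_g$ is the Riemannian volume element of $(M,g)$, and $|\nabla^\varphi(\xi\circ\varphi)|^2=\sum_ih(\nabla^\varphi_{e_i}(\xi\circ\varphi),\nabla^\varphi_{e_i}(\xi\circ\varphi))$ for any local orthonormal frame $\{e_i\}$ on $M$. The map $\varphi$ is generalized $\xi$-parallel if $\frac{d}{dt}E_\xi(\varphi_t;D)|_{t=0}=0$ for every compact domain $D\subset M$ and every smooth variation $\{\varphi_t\}$ of $\varphi$ supported in $D$ (meaning $\varphi_0=\varphi$ and $\varphi_t=\varphi$ outside the interior of $D$ for all $t$). For the curve $\gamma$ this is applied with $M=I$ with the standard metric. *)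

(* Defs.v *)
From HB Require Import structures.
From mathcomp Require Import all_boot all_order all_algebra.
From mathcomp Require Import all_classical all_reals all_analysis.
Set Implicit Arguments.
Unset Strict Implicit.
Unset Printing Implicit Defensive.
Import Order.TTheory GRing.Theory Num.Theory.
Import numFieldNormedType.Exports.
Local Open Scope classical_set_scope.
Local Open Scope ring_scope.

(* C^k on an open subset S of a finite-dimensional space V. *)
Fixpoint Ck_on (R : realType) (V W : normedModType R) (k : nat) (S : set V)
    (f : V -> W) : Prop :=
  match k with
  | 0%N => forall x, S x -> {for x, continuous f}
  | k'.+1 => (forall x, S x -> differentiable f x) /\
             (forall v, Ck_on k' S (fun x => 'D_v f x))
  end.

Definition smooth_on (R : realType) (V W : normedModType R) (S : set V)
    (f : V -> W) : Prop :=
  forall k, Ck_on k S f.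

(* The tangent space at p is identified with R^3 by means of the coordinates of
   the chart [chart_at p]; a chart a and its inverse are total functions that
   are meaningful on [dom a] and on [chart a @` dom a] respectively. *)
Record manifold3 (R : realType) := Manifold3 {
  carrier :> topologicalType;
  carrier_hausdorff : hausdorff_space carrier;
  carrier_second_countable : @second_countable carrier;
  atlas : Type;
  dom : atlas -> set carrier;
  chart : atlas -> carrier -> 'rV[R]_3;
  chart_inv : atlas -> 'rV[R]_3 -> carrier;
  chart_at : carrier -> atlas;
  dom_chart_at : forall p, dom (chart_at p) p;
  dom_open : forall a, open (dom a);
  chart_open : forall a, open (chart a @` dom a);
  chartK : forall a p, dom a p -> chart_inv a (chart a p) = p;
  chart_continuous : forall a p, dom a p -> {for p, continuous (chart a)};
  chart_inv_continuous : forall a p, dom a p ->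
    {for chart a p, continuous (chart_inv a)};
  transition_smooth : forall a b,
    smooth_on (chart a @` (dom a `&` dom b)) (chart b \o chart_inv a)
}.

Section Manifold.
Variables (R : realType) (M : manifold3 R).
Implicit Types (a : atlas M) (p q : M) (U : set M) (u v w : 'rV[R]_3)
  (X Y Z : M -> 'rV[R]_3) (f : M -> R) (I : set R) (gam : R -> M).

(* Components of v : T_p M in the chart a. *)
Definition tcoord a p v : 'rV[R]_3 :=
  'd (chart a \o chart_inv (chart_at p)) (chart (chart_at p) p) v.

(* The coordinate vector field d/dx^i of the chart a. *)
Definition coord_field a (i : 'I_3) p : 'rV[R]_3 :=
  'd (chart (chart_at p) \o chart_inv a) (chart a p) (delta_mx 0 i).

Definition local_field a X (x : 'rV[R]_3) : 'rV[R]_3 :=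
  tcoord a (chart_inv a x) (X (chart_inv a x)).

Definition smooth_fun U f :=
  forall a, smooth_on (chart a @` (U `&` dom a)) (f \o chart_inv a).

Definition smooth_vf U X :=
  forall a, smooth_on (chart a @` (U `&` dom a)) (local_field a X).

(* The derivative v(f) of f along v : T_p M. *)
Definition dirder p v f : R :=
  'D_v (f \o chart_inv (chart_at p)) (chart (chart_at p) p).

(* [X, Y]^j = X(Y^j) - Y(X^j) *)
Definition lie X Y p : 'rV[R]_3 :=
  let a := chart_at p in
  'D_(X p) (local_field a Y) (chart a p) -
  'D_(Y p) (local_field a X) (chart a p).

Record metric := Metric {
  mval :> forall p, 'rV[R]_3 -> 'rV[R]_3 -> R;
  metric_linear : forall p (x : R) u v w,
    mval p (x *: u + v) w = x * mval p u w + mval p v w;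
  metric_sym : forall p u v, mval p u v = mval p v u;
  metric_pos : forall p u, u != 0 -> 0 < mval p u u;
  metric_smooth : forall U X Y, open U -> smooth_vf U X -> smooth_vf U Y ->
    smooth_fun U (fun p => mval p (X p) (Y p))
}.

(* [D p v X] is the covariant derivative of X along v : T_p M; it is only
   constrained when X is smooth on a neighbourhood of p (locality in X follows
   from the Leibniz rule, as f need not be smooth away from p). *)
Record affine_connection (D : M -> 'rV[R]_3 -> (M -> 'rV[R]_3) -> 'rV[R]_3)
    : Prop := AffineConnection {
  conn_linear : forall U p X, open U -> U p -> smooth_vf U X ->
    forall (x : R) u v, D p (x *: u + v) X = x *: D p u X + D p v X;
  conn_add : forall U p X Y, open U -> U p -> smooth_vf U X -> smooth_vf U Y ->
    forall v, D p v (fun q => X q + Y q) = D p v X + D p v Y;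
  conn_leibniz : forall U p f X, open U -> U p ->
    smooth_fun U f -> smooth_vf U X ->
    forall v, D p v (fun q => f q *: X q) = dirder p v f *: X p + f p *: D p v X;
  conn_smooth : forall U X Y, open U -> smooth_vf U X -> smooth_vf U Y ->
    smooth_vf U (fun p => D p (X p) Y)
}.

Record levi_civita (h : metric)
    (D : M -> 'rV[R]_3 -> (M -> 'rV[R]_3) -> 'rV[R]_3) : Prop := LeviCivita {
  lc_connection : affine_connection D;
  lc_torsion_free : forall U p X Y, open U -> U p ->
    smooth_vf U X -> smooth_vf U Y ->
    D p (X p) Y - D p (Y p) X = lie X Y p;
  lc_metric : forall U p Y Z, open U -> U p ->
    smooth_vf U Y -> smooth_vf U Z -> forall v,
    dirder p v (fun q => h q (Y q) (Z q)) = h p (D p v Y) (Z p) + h p (Y p) (D p v Z)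
}.

Definition curvature (D : M -> 'rV[R]_3 -> (M -> 'rV[R]_3) -> 'rV[R]_3)
    X Y Z p : 'rV[R]_3 :=
  D p (X p) (fun q => D q (Y q) Z) - D p (Y p) (fun q => D q (X q) Z)
  - D p (lie X Y p) Z.

Definition gram (h : metric) p u v : R := h p u u * h p v v - h p u v ^+ 2.

Definition sectional_curvature (h : metric)
    (D : M -> 'rV[R]_3 -> (M -> 'rV[R]_3) -> 'rV[R]_3) X Y p : R :=
  h p (curvature D X Y Y p) (X p) / gram h p (X p) (Y p).

(* Every tangent plane at p is spanned by X p and Y p for some such X, Y. *)
Definition constant_curvature (h : metric)
    (D : M -> 'rV[R]_3 -> (M -> 'rV[R]_3) -> 'rV[R]_3) (c : R) : Prop :=
  forall U p X Y, open U -> U p -> smooth_vf U X -> smooth_vf U Y ->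
    gram h p (X p) (Y p) != 0 -> sectional_curvature h D X Y p = c.

Definition smooth_map (V : normedModType R) (S : set V) (F : V -> M) : Prop :=
  (forall z, S z -> {for z, continuous F}) /\
  (forall a, smooth_on (S `&` F @^-1` dom a) (chart a \o F)).

Definition velocity gam (t : R) : 'rV[R]_3 :=
  derive1 (chart (chart_at (gam t)) \o gam) t.

Definition smooth_along I gam (V : R -> 'rV[R]_3) : Prop :=
  forall a, smooth_on (I `&` gam @^-1` dom a) (fun t => tcoord a (gam t) (V t)).

(* The pullback connection: for V = sum_i V^i (d_i o gam) near t,
   V'(t) = sum_i (V^i)'(t) d_i + V^i(t) D_(gam'(t)) d_i.  With respect to the
   chart at gam t, the components of V t are its entries. *)
Definition cov_along (D : M -> 'rV[R]_3 -> (M -> 'rV[R]_3) -> 'rV[R]_3)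
    gam (V : R -> 'rV[R]_3) (t : R) : 'rV[R]_3 :=
  let a := chart_at (gam t) in
  derive1 (fun s => tcoord a (gam s) (V s)) t +
  \sum_(i < 3) V t 0 i *: D (gam t) (velocity gam t) (coord_field a i).

(* A continuous orientation of the spaces T_(gam t) M: o t is the sign of the
   standard basis of R^3 = T_(gam t) M, and o t times the Jacobian determinant
   of the change of coordinates is the sign of the basis of the chart a. *)
Definition orientation_along I gam (o : R -> R) : Prop :=
  forall t, I t -> (o t = 1 \/ o t = -1) /\
    forall a, dom a (gam t) ->
      let sign s := Num.sg (o s *
        \det (jacobian (chart a \o chart_inv (chart_at (gam s)))
                (chart (chart_at (gam s)) (gam s)))) in
      \forall s \near t, sign s = sign t.

Definition frame_mx u v w : 'M[R]_3 := \matrix_(i < 3) tnth [tuple u; v; w] i.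

Record frenet_frame (h : metric)
    (D : M -> 'rV[R]_3 -> (M -> 'rV[R]_3) -> 'rV[R]_3) I gam (o : R -> R)
    (T N B : R -> 'rV[R]_3) (k tau : R -> R) : Prop := FrenetFrame {
  frenet_smoothT : smooth_along I gam T;
  frenet_smoothN : smooth_along I gam N;
  frenet_smoothB : smooth_along I gam B;
  frenet_tangent : forall t, I t -> T t = velocity gam t;
  frenet_unit : forall t, I t -> [/\ h (gam t) (T t) (T t) = 1,
    h (gam t) (N t) (N t) = 1 & h (gam t) (B t) (B t) = 1];
  frenet_orthogonal : forall t, I t -> [/\ h (gam t) (T t) (N t) = 0,
    h (gam t) (T t) (B t) = 0 & h (gam t) (N t) (B t) = 0];
  frenet_oriented : forall t, I t -> 0 < o t * \det (frame_mx (T t) (N t) (B t));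
  frenet_curvature : forall t, I t ->
    k t = Num.sqrt (h (gam t) (cov_along D gam T t) (cov_along D gam T t));
  frenet_eqT : forall t, I t -> cov_along D gam T t = k t *: N t;
  frenet_eqN : forall t, I t ->
    cov_along D gam N t = - k t *: T t + tau t *: B t;
  frenet_eqB : forall t, I t -> cov_along D gam B t = - tau t *: N t
}.

Definition xi_energy (h : metric)
    (D : M -> 'rV[R]_3 -> (M -> 'rV[R]_3) -> 'rV[R]_3) (xi : M -> 'rV[R]_3)
    gam (a b : R) : R :=
  2^-1 * \int[lebesgue_measure]_(s in `[a, b])
    h (gam s) (cov_along D gam (xi \o gam) s) (cov_along D gam (xi \o gam) s).

(* Phi t is a smooth variation of gam, |t| < eps, supported in [a, b]. *)
Record smooth_variation I gam (a b eps : R) (Phi : R -> R -> M) : Prop :=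
    SmoothVariation {
  variation_smooth : smooth_map [set z : R * R | (- eps < z.1 < eps) /\ I z.2]
    (fun z => Phi z.1 z.2);
  variation_start : forall s, I s -> Phi 0 s = gam s;
  variation_support : forall t s, - eps < t < eps -> I s -> s \notin `]a, b[ ->
    Phi t s = gam s
}.

Definition generalized_xi_parallel (h : metric)
    (D : M -> 'rV[R]_3 -> (M -> 'rV[R]_3) -> 'rV[R]_3) (xi : M -> 'rV[R]_3)
    I gam : Prop :=
  forall (a b eps : R) (Phi : R -> R -> M),
    a < b -> `[a, b]%classic `<=` I -> 0 < eps ->
    smooth_variation I gam a b eps Phi ->
    is_derive (0 : R) (1 : R) (fun t => xi_energy h D xi (Phi t) a b) 0.

End Manifold.

(* Main.v *)
(* For a variation Phi of gam put V = d Phi/dt and T = d Phi/ds.  Since xi is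
   pulled back from M, D_s xi = D_T xi, so that half the t-derivative of
   |D_s xi|^2 is h(D_t D_s xi, D_s xi), that is
     d/ds h(D_V xi, D_s xi) - h(D_V xi, D_s D_s xi) + h(R(V, T) xi, D_s xi).
   Integrating along gam, where V vanishes at the end points, the boundary term
   disappears; in constant curvature R(V, T) xi = c (h(T, xi) V - h(V, xi) T).
   Bump variations supported near a point then show that gam is generalized
   xi-parallel iff
     h(D_V xi, D_s D_s xi) = c (h(T, xi) h(V, D_s xi) - h(V, xi) h(T, D_s xi))
   for all V along gam.  In the Frenet frame D_s xi = alpha T + beta N + delta B,
   and V = T, N, B give the three conditions: for V = T the right-hand side is 0
   and the left-hand side is half the derivative of alpha^2 + beta^2 + delta^2. *)
Require Import Defs.
From HB Require Import structures.
From mathcomp Require Import all_boot all_order all_algebra.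
From mathcomp Require Import all_classical all_reals all_analysis.
From mathcomp Require Import ring lra.
Import Order.TTheory GRing.Theory Num.Theory.
Import numFieldNormedType.Exports.
Local Open Scope classical_set_scope.
Local Open Scope ring_scope.

Set Implicit Arguments.
Unset Strict Implicit.
Unset Printing Implicit Defensive.

(** * Maps of class C^k *)

(** A tangent vector is stored by its components in [chart_at p], a choice that may jump from point
    to point, so raw components carry no regularity; and [D] is constrained only on fields of M
    smooth near a point, so a second covariant derivative along a variation is not a value of [D] on
    such a field. The remedy is to work in one fixed chart with fields of constant components. They
    commute and span, and h(D_u xi, D_w xi) becomes a polynomial in the components of u and w whose
    coefficients are smooth in the base point, to which ordinary calculus applies. The commutator of
    D_t and D_s on xi then reduces to curvature because the second partial derivatives of the
    coordinates of the variation are symmetric. Constant curvature is a hypothesis on sectional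
    curvatures only, so the full tensor has to be recovered by polarization. Continuity of the Euler
    form along the curve is obtained from the variation formula itself, hence only on variation
    fields; this is why the localization uses two successive bumps. *)

Section NearDifferentiable.
Variables (R : realType) (V W : normedModType R).
Implicit Types f g : V -> W.

(** The difference of the two functions vanishes near x, hence is o(id) there; the first-order
    expansion of f is thus one of g, and a differential is unique. *)
Lemma near_eq_diff f g x : (\near x, f x = g x) -> differentiable f x ->
  differentiable g x /\ 'd g x = 'd f x :> (V -> W).
Proof.
move=> fg df.
have gE : g \o shift x = cst (g x) + 'd f x +o_ 0 id.
  have g0 : (g \o shift x) - (f \o shift x) =o_ (0 : V) (id : V -> V).
    apply/eqoP => e e0.
    have : \forall z \near (0 : V), f (z + x) = g (z + x).
      by move: fg => /nbhs0P; apply: filterS => z; rewrite addrC.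
    apply: filterS => z /= fgz.
    by rewrite /= !fctE /= fgz subrr normr0 mulr_ge0 // ltW.
  have -> : g \o shift x = (g \o shift x - (f \o shift x)) + (f \o shift x).
    by rewrite subrK.
  rewrite g0 (diff_locally df) -(nbhs_singleton fg) addrC -addrA.
  by rewrite addo.
have dgE : 'd g x = 'd f x :> (V -> W).
  by apply: diff_unique => //; exact: diff_continuous.
split => //; apply/diff_locallyP; rewrite dgE; split => //.
exact: diff_continuous.
Qed.

Lemma near_eq_differentiable f g x : (\near x, f x = g x) ->
  differentiable f x -> differentiable g x.
Proof. by move=> fg /(near_eq_diff fg)[]. Qed.

End NearDifferentiable.

Section ScaleDerive.
Variables (R : realType) (V W : normedModType R).

(** Registered as a bilinear map so that the general differentiation rule for continuous bilinear
    maps yields the product rule with a vector-valued factor. *)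
Lemma scale_is_bilinear : bilinear_for
    (GRing.Scale.Law.clone _ _ *:%R _) (GRing.Scale.Law.clone _ _ *:%R _)
    (@GRing.scale R W : R -> W -> W).
Proof.
split=> [u'|u] a x y /=; first by rewrite scalerDl scalerA.
by rewrite scalerDr !scalerA mulrC.
Qed.
HB.instance Definition _ := bilinear_isBilinear.Build R R W W _ _
  (@GRing.scale R W : R -> W -> W) scale_is_bilinear.

Lemma differentiable_scale (f : V -> R) (g : V -> W) x :
  differentiable f x -> differentiable g x ->
  differentiable (fun y => f y *: g y) x /\
  forall v, 'd (fun y => f y *: g y) x v = 'd f x v *: g x + f x *: 'd g x v.
Proof.
move=> df dg.
have sc : continuous (fun p : R * W => p.1 *: p.2) by exact: scale_continuous.
have sd p : differentiable (fun p : R * W => p.1 *: p.2) p.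
  exact: (@differentiable_bilin _ _ _ _ (@GRing.scale R W : R -> W -> W)).
have -> : (fun y => f y *: g y) = (fun p : R * W => p.1 *: p.2) \o (fun y => (f y, g y)).
  by [].
split; first by apply: differentiable_comp => //; exact: differentiable_pair.
move=> v; rewrite diff_comp //; last exact: differentiable_pair.
rewrite /= (@diff_bilin _ _ _ _ (@GRing.scale R W : R -> W -> W)) //.
by rewrite diff_pair //= addrC.
Qed.

End ScaleDerive.

Section Ck.
Variables (R : realType) (V W : normedModType R).
Implicit Types (S : set V) (f g : V -> W).

Lemma Ck_on_sub k S T f : T `<=` S -> Ck_on k S f -> Ck_on k T f.
Proof.
elim: k f => [|k IH] f TS /=; first by move=> + x /TS; apply.
by move=> [df Df]; split=> [x /TS|v]; [exact: df|exact: IH].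
Qed.

(** Derivatives in [Ck_on] are those of the total function, so the condition is pointwise in S. This
    lets smoothness be checked at each point in a chart chosen for that point. *)
Lemma Ck_on_pt k S f : (forall x, S x -> Ck_on k [set x] f) -> Ck_on k S f.
Proof.
elim: k f => [|k IH] f Sf /=; first by move=> x Sx; exact: (Sf x Sx).
split=> [x Sx|v]; first by have [df _] := Sf x Sx; exact: df.
by apply: IH => x Sx; have [_ Df] := Sf x Sx; exact: Df.
Qed.

Lemma Ck_onW k S f : Ck_on k.+1 S f -> Ck_on k S f.
Proof.
elim: k f => [|k IH] f [df Df] /=.
  by move=> x Sx; apply: differentiable_continuous; exact: df.
by split => // v; apply: IH; exact: Df.
Qed.

Lemma Ck_on_eq k S f g : open S -> (forall x, S x -> f x = g x) ->
  Ck_on k S f -> Ck_on k S g.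
Proof.
move=> oS; elim: k f g => [|k IH] f g fg /=.
  move=> Cf x Sx; have Sn : nbhs x S by exact: open_nbhs_nbhs.
  have := Cf x Sx; rewrite /prop_for /continuous_at -(fg x Sx).
  apply: cvg_trans; apply: near_eq_cvg.
  by apply: filterS Sn => y Sy; exact: fg.
move=> [df Df].
have fgn x : S x -> \near x, f x = g x.
  move=> Sx; have : nbhs x S by exact: open_nbhs_nbhs.
  by apply: filterS => y; exact: fg.
split=> [x Sx|v]; first exact: near_eq_differentiable (fgn x Sx) (df x Sx).
by apply: IH (Df v) => x Sx; apply: near_eq_derive; exact: fgn.
Qed.

(** The common inductive step of the closure properties below: a formula for the derivative is only
    required to hold on S. *)
Lemma Ck_onS k S f (Df : V -> V -> W) : open S ->
  (forall x, S x -> differentiable f x) ->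
  (forall v x, S x -> 'd f x v = Df v x) ->
  (forall v, Ck_on k S (Df v)) -> Ck_on k.+1 S f.
Proof.
move=> oS df DfE CDf; split => // v.
by apply: Ck_on_eq (CDf v) => // x Sx; rewrite deriveE ?DfE//; exact: df.
Qed.

Lemma Ck_on_d k S f v : open S -> Ck_on k.+1 S f -> Ck_on k S (fun x => 'd f x v).
Proof.
move=> oS [df Df]; apply: Ck_on_eq (Df v) => // x Sx.
by rewrite deriveE//; exact: df.
Qed.

Lemma Ck_on_cst k S (w : W) : Ck_on k S (cst w).
Proof.
elim: k w => [|k IH] w /=; first by move=> x _; exact: cst_continuous.
split=> [x _|v]; first exact: differentiable_cst.
by rewrite (_ : (fun x => _) = cst 0)//; apply/funext => x; rewrite derive_cst.
Qed.

Lemma Ck_onD k S f g : open S -> Ck_on k S f -> Ck_on k S g ->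
  Ck_on k S (fun x => f x + g x).
Proof.
move=> oS; elim: k f g => [|k IH] f g Cf Cg.
  by move=> x Sx; apply: continuousD; [exact: Cf|exact: Cg].
apply: (@Ck_onS _ _ _ (fun v x => 'd f x v + 'd g x v)) => //.
- by move=> x Sx; apply: differentiableD; [exact: Cf.1|exact: Cg.1].
- move=> v x Sx; rewrite (_ : (fun x => _) = f + g)//.
  by rewrite diffD//; [exact: Cf.1|exact: Cg.1].
- by move=> v; apply: IH; exact: Ck_on_d.
Qed.

Lemma Ck_on_sum k S n (f : 'I_n -> V -> W) : open S -> (forall i, Ck_on k S (f i)) ->
  Ck_on k S (fun x => \sum_(i < n) f i x).
Proof.
move=> oS; elim: n f => [|n IH] f Cf.
  rewrite (_ : (fun x => _) = cst 0); first exact: Ck_on_cst.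
  by apply/funext => x; rewrite big_ord0.
rewrite (_ : (fun x => _) = fun x => \sum_(i < n) f (widen_ord (leqnSn n) i) x + f ord_max x).
  by apply: Ck_onD => //; exact: IH.
by apply/funext => x; rewrite big_ord_recr.
Qed.

End Ck.

Section CkScale.
Variables (R : realType) (V W : normedModType R).

Lemma Ck_onZ k (S : set V) (f : V -> R) (g : V -> W) : open S -> Ck_on k S f -> Ck_on k S g ->
  Ck_on k S (fun x => f x *: g x).
Proof.
move=> oS; elim: k f g => [|k IH] f g Cf Cg.
  by move=> x Sx; apply: cvgZ; [exact: Cf|exact: Cg].
apply: (@Ck_onS _ _ _ _ _ _ (fun v x => 'd f x v *: g x + f x *: 'd g x v)) => //.
- by move=> x Sx; apply: (differentiable_scale _ _).1; [exact: Cf.1|exact: Cg.1].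
- by move=> v x Sx; apply: (differentiable_scale _ _).2; [exact: Cf.1|exact: Cg.1].
- by move=> v; apply: Ck_onD => //; apply: IH;
    solve [exact: Ck_on_d | exact: Ck_onW].
Qed.

End CkScale.

Section CkComp.
Variables (R : realType) (U V W : normedModType R).

Lemma Ck_on_linl k (S : set U) (f : U -> V) (L : {linear V -> W}) :
  continuous L -> open S -> Ck_on k S f -> Ck_on k S (fun x => L (f x)).
Proof.
move=> cL oS; elim: k f => [|k IH] f Cf.
  by move=> x Sx; apply: continuous_comp; [exact: Cf|exact: cL].
apply: (@Ck_onS _ _ _ _ _ _ (fun v x => L ('d f x v))) => //.
- move=> x Sx; apply: (@differentiable_comp _ _ _ _ f L); first exact: Cf.1.
  exact: linear_differentiable.
- move=> v x Sx; rewrite (@diff_comp _ _ _ _ f L) //.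
  + by rewrite /= diff_lin.
  + exact: Cf.1.
  + exact: linear_differentiable.
- by move=> v; apply: IH; exact: Ck_on_d.
Qed.

Lemma Ck_on_linr k (S : set V) (f : V -> W) (L : {linear U -> V}) :
  continuous L -> open S -> Ck_on k S f ->
  Ck_on k [set x | S (L x)] (fun x => f (L x)).
Proof.
move=> cL oS.
have oLS : open [set x | S (L x)] by apply: open_comp oS => x _; exact: cL.
elim: k f => [|k IH] f Cf.
  by move=> x Sx; apply: continuous_comp; [exact: cL|exact: Cf].
apply: (@Ck_onS _ _ _ _ _ _ (fun v x => 'd f (L x) (L v))) => //.
- move=> x Sx; apply: (@differentiable_comp _ _ _ _ L f).
    exact: linear_differentiable.
  exact: Cf.1.
- move=> v x Sx; rewrite (@diff_comp _ _ _ _ L f) //.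
  + by rewrite /= diff_lin.
  + exact: linear_differentiable.
  + exact: Cf.1.
- by move=> v; apply: (IH (fun x => 'd f x (L v))); exact: Ck_on_d.
Qed.

End CkComp.

Section CkCoord.
Variables (R : realType) (n : nat).

Definition rV_coord (i : 'I_n) (v : 'rV[R]_n) : R := v ord0 i.

Lemma rV_coord_linear i : linear (rV_coord i).
Proof. by move=> a u v; rewrite /rV_coord !mxE. Qed.
HB.instance Definition _ i := GRing.isLinear.Build R 'rV[R]_n R _ (rV_coord i)
  (rV_coord_linear i).

Lemma rV_coord_continuous i : continuous (rV_coord i).
Proof. exact: coord_continuous. Qed.

End CkCoord.

Section CkComprV.
Variables (R : realType) (n : nat) (V W : normedModType R).

Lemma Ck_on_coord k (S : set V) (f : V -> 'rV[R]_n) i : open S ->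
  Ck_on k S f -> Ck_on k S (fun x => f x 0 i).
Proof.
by move=> oS; apply: (@Ck_on_linl _ _ _ _ k S f (rV_coord i : {linear _ -> _})) => //;
  exact: rV_coord_continuous.
Qed.

(** In the chain rule f is differentiated in the direction 'd g x v, which moves with x, whereas
    [Ck_on] speaks of fixed directions. Expanding this direction in the standard basis turns the
    derivative into a sum of products covered by the induction. *)
Lemma Ck_on_comp k (S : set V) (T : set 'rV[R]_n) (f : 'rV[R]_n -> W) (g : V -> 'rV[R]_n) :
  open S -> open T -> (forall x, S x -> T (g x)) ->
  Ck_on k S g -> Ck_on k T f -> Ck_on k S (fun x => f (g x)).
Proof.
move=> oS oT ST; elim: k f => [|k IH] f Cg Cf.
  by move=> x Sx; apply: continuous_comp; [exact: Cg|exact/Cf/ST].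
apply: (@Ck_onS _ _ _ _ _ _
    (fun v x => \sum_(i < n) ('d g x v) 0 i *: 'd f (g x) (delta_mx 0 i))) => //.
- move=> x Sx; apply: (@differentiable_comp _ _ _ _ g f); first exact: Cg.1.
  exact/Cf.1/ST.
- move=> v x Sx; rewrite (@diff_comp _ _ _ _ g f) //.
  + by rewrite /= {1}(row_sum_delta ('d g x v)) linear_sum; apply: eq_bigr => i _;
      rewrite linearZ.
  + exact: Cg.1.
  + exact/Cf.1/ST.
- move=> v; apply: Ck_on_sum => // i; apply: Ck_onZ => //.
    by apply: Ck_on_coord => //; exact: Ck_on_d.
  by apply: (IH (fun y => 'd f y (delta_mx 0 i))); [exact: Ck_onW|exact: Ck_on_d].
Qed.

End CkComprV.

(** * Symmetry of second derivatives *)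

Section Line.
Variables (R : realType) (V W : normedModType R).

Lemma is_derive_line (f : V -> W) (p u : V) (s : R) : differentiable f (p + s *: u) ->
  is_derive s 1 (fun s : R => f (p + s *: u)) ('d f (p + s *: u) u).
Proof.
move=> df.
have dl : is_diff s (fun s : R => p + s *: u) ( *:%R^~ u).
  have -> : (fun s : R => p + s *: u) = cst p + *:%R^~ u by [].
  by apply: is_diff_eq; rewrite add0r.
have df2 : differentiable (fun s : R => f (p + s *: u)) s.
  by apply: (@differentiable_comp _ _ _ _ (fun s : R => p + s *: u) f).
apply: DeriveDef; first exact: diff_derivable.
rewrite deriveE// (@diff_comp _ _ _ _ (fun s : R => p + s *: u) f)//=.
by rewrite diff_val scale1r.
Qed.

End Line.

Section Schwarz.
Variables (R : realType) (V : normedModType R) (S : set V) (f : V -> R).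
Hypothesis Cf : Ck_on 2 S f.

(** The mean value theorem is applied twice: in the direction u to s |-> f (x + r v + s u) - f (x +
    s u), then in the direction v to the derivative along u so obtained. *)
Lemma second_difference_mean x u v r : 0 < r ->
  (forall s t, 0 <= s <= r -> 0 <= t <= r -> S (x + s *: u + t *: v)) ->
  exists s t, [/\ 0 <= s <= r, 0 <= t <= r &
    f (x + r *: u + r *: v) - f (x + r *: u) - f (x + r *: v) + f x =
    r ^+ 2 * 'D_v ('D_u f) (x + s *: u + t *: v)].
Proof.
move=> r0 Sr; have r0' := ltW r0.
have S0 s : 0 <= s <= r -> S (x + s *: u).
  by move=> s01; have := Sr s 0 s01; rewrite scale0r addr0 lexx r0'; apply.
have S1 s : 0 <= s <= r -> S (x + r *: v + s *: u).
  by move=> s01; rewrite addrAC; apply: Sr => //; rewrite lexx r0'.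
have dphi s : 0 <= s <= r ->
  is_derive s 1 (fun s : R => f (x + r *: v + s *: u) - f (x + s *: u))
    ('d f (x + r *: v + s *: u) u - 'd f (x + s *: u) u).
  move=> s01.
  by apply: is_deriveB; apply: is_derive_line; apply: Cf.1; [exact: S1|exact: S0].
have itv s : s \in `]0, r[ -> 0 <= s <= r.
  by rewrite in_itv /= => /andP[a b]; rewrite !ltW.
have [|s /=] := @MVT _ _ _ _ _ r0 (fun s sI => dphi s (itv s sI)).
  by apply: derivable_within_continuous => s; rewrite in_itv /= => s01;
    case: (dphi s s01).
rewrite in_itv /= => /andP[s0 sr] e1.
have s01 : 0 <= s <= r by rewrite !ltW.
have [dDu _] := Cf.2 u.
have dpsi t : 0 <= t <= r ->
  is_derive t 1 (fun t : R => 'D_u f (x + s *: u + t *: v))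
    ('d ('D_u f) (x + s *: u + t *: v) v).
  by move=> t01; apply: is_derive_line; apply: dDu; exact: Sr.
have [|t /=] := @MVT _ _ _ _ _ r0 (fun s sI => dpsi s (itv s sI)).
  by apply: derivable_within_continuous => t; rewrite in_itv /= => t01;
    case: (dpsi t t01).
rewrite in_itv /= => /andP[t0 tr] e2.
have t01 : 0 <= t <= r by rewrite !ltW.
exists s, t; split => //.
rewrite deriveE; last by apply: dDu; exact: Sr.
move: e1 e2; rewrite !scale0r !addr0 !subr0.
rewrite deriveE; last by apply: Cf.1; apply: Sr => //; rewrite lexx r0'.
rewrite deriveE; last by apply: Cf.1; exact: S0.
rewrite (addrAC x (s *: u)) (addrAC x (r *: u)) => e1 e2.
by rewrite expr2 -mulrA (mulrC r) [r * _]mulrC -e2 -e1; ring.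
Qed.

End Schwarz.

Lemma open_continuous_ball (R : realType) (V : normedModType R) (S : set V) (A B : V -> R) x e :
  open S -> S x -> {for x, continuous A} -> {for x, continuous B} -> 0 < e ->
  exists2 d : R, 0 < d &
    forall y, ball x d y -> [/\ S y, `|A x - A y| < e & `|B x - B y| < e].
Proof.
move=> oS Sx cA cB e0.
have nS : nbhs x S by exact: open_nbhs_nbhs.
have nA : nbhs x [set y | `|A x - A y| < e] by exact: ((cvgrPdist_lt _ _).1 cA _ e0).
have nB : nbhs x [set y | `|B x - B y| < e] by exact: ((cvgrPdist_lt _ _).1 cB _ e0).
have [d /= d0 dAB] := (nbhs_ballP _ _).1 (filterI nS (filterI nA nB)).
by exists d => // y /dAB[Sy [Ay By]].
Qed.

(** The second difference is symmetric in u and v, so some value of one mixed derivative equals some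
    value of the other, both taken near x. This is impossible if the two differ at x and each varies
    by less than half their gap. *)
Lemma schwarz_real (R : realType) (V : normedModType R) (S : set V) (f : V -> R) x u v :
  open S -> Ck_on 2 S f -> S x -> 'D_u ('D_v f) x = 'D_v ('D_u f) x.
Proof.
have aux1 (a b : R) : 0 <= a -> 0 <= b -> a + b < 2 * (1 + a + b) by move=> *; lra.
have aux2 (p q y : R) : `|p - y| < `|p - q| / 2 -> `|q - y| < `|p - q| / 2 -> False.
  have := ler_normD (p - y) (y - q); rewrite subrKA [`|y - q|]distrC.
  by move: `|p - q| `|p - y| `|q - y| => * ; lra.
move=> oS Cf Sx; apply/eqP/negP => /negP ne.
set A : V -> R := 'D_u ('D_v f) in ne *; set B : V -> R := 'D_v ('D_u f) in ne *.
have e0 : 0 < `|A x - B x| / 2 by rewrite divr_gt0// normr_gt0 subr_eq0.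
have cA : {for x, continuous A} := (Cf.2 v).2 u x Sx.
have cB : {for x, continuous B} := (Cf.2 u).2 v x Sx.
have [d d0 dA] := open_continuous_ball oS Sx cA cB e0.
(* With this r the parallelogram spanned by r u and r v at x lies in the ball of radius d, and the 1
   keeps the denominator positive when u and v vanish. *)
pose r := d / (2 * (1 + `|u| + `|v|)).
have n0 : 0 < 1 + `|u| + `|v| by rewrite -addrA ltr_pwDl// addr_ge0.
have r0 : 0 < r by rewrite divr_gt0// mulr_gt0.
have rd : d = r * (2 * (1 + `|u| + `|v|)) by rewrite /r divfK// gt_eqF// mulr_gt0.
clearbody r.
have inb s t : 0 <= s <= r -> 0 <= t <= r -> ball x d (x + s *: u + t *: v).
  move=> /andP[s0 sr] /andP[t0 tr]; rewrite -ball_normE /=.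
  rewrite -addrA opprD addNKr normrN (le_lt_trans (ler_normD _ _))//.
  rewrite !normrZ !ger0_norm//.
  apply: (@le_lt_trans _ _ (r * (`|u| + `|v|))).
    by rewrite mulrDr lerD// ler_wpM2r.
  rewrite rd.
  by rewrite ltr_pM2l// aux1.
have Sr s t : 0 <= s <= r -> 0 <= t <= r -> S (x + s *: u + t *: v).
  by move=> s01 t01; have [] := dA _ (inb s t s01 t01).
have Sr' s t : 0 <= s <= r -> 0 <= t <= r -> S (x + s *: v + t *: u).
  by move=> s01 t01; rewrite addrAC; exact: Sr.
have [s [t [s01 t01 e1]]] := second_difference_mean Cf r0 Sr.
have [s' [t' [s01' t01' e2]]] := second_difference_mean Cf r0 Sr'.
have AB : A (x + s' *: v + t' *: u) = B (x + s *: u + t *: v).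
  apply: (@mulfI _ (r ^+ 2)); first by rewrite gt_eqF// exprn_gt0.
  apply: etrans (esym e2) _; apply: etrans _ e1.
  by rewrite (addrAC x (r *: v)); congr (_ + _); exact: addrAC.
have [_ _ b1] := dA _ (inb s t s01 t01).
have [_ a1 _] := dA _ (inb t' s' t01' s01').
move: a1; rewrite addrAC AB.
by move=> a1; exact: (aux2 _ _ _ a1 b1).
Qed.

Lemma schwarz (R : realType) (V : normedModType R) n (S : set V) (f : V -> 'rV[R]_n) x u v :
  open S -> Ck_on 2 S f -> S x -> 'D_u ('D_v f) x = 'D_v ('D_u f) x.
Proof.
move=> oS Cf Sx; have [df Df] := Cf.
have Di w y : S y -> 'D_w f y = \row_i 'D_w (fun t => f t 0 i) y.
  move=> Sy; rewrite derive_mx; last by apply: diff_derivable; exact: df.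
  by apply/matrixP => i j; rewrite !mxE ord1.
have Dij w z : 'D_w ('D_z f) x = \row_i 'D_w ('D_z (fun t => f t 0 i)) x.
  rewrite derive_mx; last by apply: diff_derivable; exact: (Df z).1.
  apply/matrixP => i j; rewrite !mxE ord1; apply: near_eq_derive.
  have : nbhs x S by exact: open_nbhs_nbhs.
  by apply: filterS => y Sy; rewrite Di // mxE.
apply: etrans (Dij u v) _.
apply: etrans _ (esym (Dij v u)).
apply/matrixP => a i.
rewrite [LHS]mxE [RHS]mxE.
apply: (@schwarz_real _ _ S) => //.
exact: (@Ck_on_coord _ _ _ 2).
Qed.

(** * Linear maps and composition with functions of one real variable *)

Section CkLinear.
Variables (R : realType) (V W : normedModType R).

Lemma Ck_on_lin k (S : set V) (L : {linear V -> W}) : continuous L -> open S ->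
  Ck_on k S L.
Proof.
move=> cL oS; elim: k => [|k IH]; first by move=> x _; exact: cL.
apply: (@Ck_onS _ _ _ _ _ _ (fun v x => L v)) => //.
- by move=> x _; exact: linear_differentiable.
- by move=> v x _; rewrite diff_lin.
- by move=> v; exact: Ck_on_cst.
Qed.

Lemma Ck_on_compR k (S : set V) (T : set R) (f : R -> W) (g : V -> R) :
  open S -> open T -> (forall x, S x -> T (g x)) ->
  Ck_on k S g -> Ck_on k T f -> Ck_on k S (fun x => f (g x)).
Proof.
move=> oS oT ST; elim: k f => [|k IH] f Cg Cf.
  by move=> x Sx; apply: continuous_comp; [exact: Cg|exact/Cf/ST].
apply: (@Ck_onS _ _ _ _ _ _ (fun v x => 'd g x v *: 'd f (g x) 1)) => //.
- move=> x Sx; apply: (@differentiable_comp _ _ _ _ g f); first exact: Cg.1.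
  exact/Cf.1/ST.
- move=> v x Sx; rewrite (@diff_comp _ _ _ _ g f) //.
  + by rewrite /= -linearZ /= [_ *: _]mulr1.
  + exact: Cg.1.
  + exact/Cf.1/ST.
- move=> v; apply: Ck_onZ => //; first exact: Ck_on_d.
  by apply: (IH (fun y => 'd f y 1)); [exact: Ck_onW|exact: Ck_on_d].
Qed.

End CkLinear.

(** * A smooth bump function *)

Section Bump.
Variable R : realType.

(** The powers of 1/x make the family stable under differentiation up to linear combinations, so
    that one induction on the order proves all its members smooth. *)
Definition flat n (x : R) : R := if 0 < x then x^-1 ^+ n * expR (- x^-1) else 0.

Lemma flat_ge0 n x : 0 <= flat n x.
Proof.
rewrite /flat; case: ifP => // x0; rewrite mulr_ge0 ?expR_ge0//.
by rewrite exprn_ge0// invr_ge0 ltW.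
Qed.

Lemma flat0_le1 x : flat 0 x <= 1.
Proof.
rewrite /flat; case: ifP => // x0; rewrite expr0 mul1r expR_le1.
by rewrite oppr_le0 invr_ge0 ltW.
Qed.

(** Bounds the difference quotient at 0 by a multiple of x, comparing exp(1/x) with the term of
    degree n + 2 of its series. *)
Lemma flat_le n x : 0 <= x -> x^-1 * flat n x <= n.+2`!%:R * x.
Proof.
rewrite le_eqVlt => /orP[/eqP<-|x0]; first by rewrite invr0 mul0r mulr0.
rewrite /flat x0 mulrA -exprS expRN ler_pdivrMr ?expR_gt0//.
have i0 : 0 <= x^-1 by rewrite invr_ge0 ltW.
apply: (@le_trans _ _ (n.+2`!%:R * x * (x^-1 ^+ n.+2 / n.+2`!%:R))).
  rewrite (exprS _ n.+1) [leRHS](_ : _ =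
    (n.+2`!%:R / n.+2`!%:R) * (x * x^-1) * x^-1 ^+ n.+1); last by ring.
  by rewrite !divff ?mul1r// ?gt_eqF// ltr0n fact_gt0.
rewrite ler_wpM2l//; first by rewrite mulr_ge0// ltW.
by apply: le_trans (expR_ge1Dxn n.+1 i0); rewrite lerDr.
Qed.

Lemma is_derive_flat n (x : R) :
  is_derive x (1:R) (flat n) (flat n.+2 x - n%:R * flat n.+1 x).
Proof.
have [x0|x0|<-] := ltrgtP 0 x.
- have x1 : x != 0 by rewrite gt_eqF.
  apply: (@near_eq_is_derive _ _ _ (fun y : R => y^-1 ^+ n * expR (- y^-1))).
    have : \forall y \near x, 0 < y by exact: lt_nbhsr.
    by apply: filterS => y y0; rewrite /flat y0.
  have dV : is_derive x 1 (fun y : R => y^-1) (- x^-1 ^+ 2).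
    apply: DeriveDef; first exact: derivableV.
    by rewrite deriveV// derive_id /GRing.scale /= mulr1 exprVn.
  have dX : is_derive x 1 (fun y : R => y^-1 ^+ n) (n%:R * x^-1 ^+ n.-1 * - x^-1 ^+ 2).
    rewrite (_ : (fun y : R => y^-1 ^+ n) = (fun y => y^-1) ^+ n); last first.
      by apply/funext => y; elim: (n) => [|m IHm]; rewrite ?expr0// !exprS IHm.
    by apply: is_derive_eq; rewrite -mulr_natl.
  have dE : is_derive x 1 (fun y : R => expR (- y^-1)) (expR (- x^-1) * x^-1 ^+ 2).
    have d1 : is_derive x 1 (fun y : R => - y^-1) (x^-1 ^+ 2).
      by rewrite -[X in is_derive _ _ _ X]opprK; exact: is_deriveN.
    have dexp : is_derive (- x^-1) 1 expR (expR (- x^-1)) by exact: is_derive_expR.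
    have := @is_derive1_comp _ expR (fun y : R => - y^-1) x _ _ dexp d1; apply.
  apply: (@is_derive_eq _ _ _ _ _ _ _ _ (is_deriveM dX dE)).
  rewrite /flat x0 /GRing.scale /=; case: n {dX} => [|n] /=.
    by rewrite !expr0; ring.
  by rewrite !exprS; ring.
- have fE m : flat m x = 0 by rewrite /flat ltNge (ltW x0).
  rewrite !fE mulr0 subrr.
  apply: (@near_eq_is_derive _ _ _ (cst 0)).
    have : \forall y \near x, y < 0 by exact: lt_nbhsl.
    by apply: filterS => y y0; rewrite /flat ltNge (ltW y0).
- have fE m : flat m 0 = 0 by rewrite /flat ltxx.
  rewrite !fE mulr0 subrr.
  (* The difference quotient at 0 is zero on the left and at most (n+2)! h on the right. *)
  have cv : h^-1 *: ((flat n \o shift 0) (h *: 1) - flat n 0) @[h --> 0^'] --> 0.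
    apply/cvgrPdist_le => /= e e0.
    have M0 : 0 < n.+2`!%:R :> R by rewrite ltr0n fact_gt0.
    near=> h; rewrite sub0r normrN fE subr0 addr0 [h *: 1]mulr1 /GRing.scale /=.
    have [h0|h0] := leP h 0; first by rewrite /flat ltNge h0 mulr0 normr0 ltW.
    rewrite ger0_norm; last by rewrite mulr_ge0 ?flat_ge0// invr_ge0 ltW.
    apply: (le_trans (flat_le _ (ltW h0))).
    rewrite mulrC -ler_pdivlMr// (le_trans (ler_norm _))//.
    near: h; apply: dnbhs0_le; exact: divr_gt0.
  apply: DeriveDef; first by apply/cvg_ex; exists 0.
  exact/cvg_lim.
Unshelve. all: by end_near. Qed.

Lemma smooth_flat n : smooth_on setT (flat n).
Proof.
move=> k; elim: k n => [|k IH] n.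
  move=> x _; apply: differentiable_continuous; apply/derivable1_diffP.
  by case: (is_derive_flat n x).
have df x : differentiable (flat n) x.
  by apply/derivable1_diffP; case: (is_derive_flat n x).
apply: (@Ck_onS _ _ _ _ _ _
  (fun v x : R => v *: (flat n.+2 x + (- n%:R) *: flat n.+1 x) : R)) => //.
- exact: openT.
- move=> v x _; rewrite diff1E//= derive1E.
  by have [_ ->] := is_derive_flat n x; rewrite [(- _) *: _]mulNr.
- by move=> v; apply: Ck_onZ; [exact: openT|exact: Ck_on_cst|];
    apply: Ck_onD; [exact: openT|exact: IH|]; apply: Ck_onZ;
    [exact: openT|exact: Ck_on_cst|exact: IH].
Qed.

Definition bump a b (x : R) : R := flat 0 (x - a) * flat 0 (b - x).

Lemma bump_ge0 a b x : 0 <= bump a b x.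
Proof. by rewrite mulr_ge0 ?flat_ge0. Qed.

Lemma bump_le1 a b x : bump a b x <= 1.
Proof. by rewrite mulr_ile1 ?flat_ge0 ?flat0_le1. Qed.

Lemma bump_gt0 a b x : a < x < b -> 0 < bump a b x.
Proof.
move=> /andP[ax xb]; rewrite /bump /flat !subr_gt0 ax xb.
by rewrite !expr0 !mul1r mulr_gt0// expR_gt0.
Qed.

Lemma bump_eq0 a b x : ~~ (a < x < b) -> bump a b x = 0.
Proof.
rewrite negb_and /bump /flat !subr_gt0.
by move=> /orP[/negbTE ->|/negbTE ->]; rewrite ?mul0r ?mulr0.
Qed.

Lemma smooth_affine (c d : R) : smooth_on setT (fun x : R => c + d *: x).
Proof.
move=> k; apply: Ck_onD; [exact: openT|exact: Ck_on_cst|].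
by apply: (@Ck_on_lin _ _ _ _ _ ( *:%R d : {linear R -> R}));
  [exact: scaler_continuous|exact: openT].
Qed.

Lemma smooth_bump a b : smooth_on setT (bump a b).
Proof.
move=> k; apply: (@Ck_onZ _ _ R); first exact: openT.
- apply: (@Ck_on_compR _ _ _ _ _ setT (flat 0) (fun x => x - a)) => //; try exact: openT.
    have := @smooth_affine (- a) 1 k; congr Ck_on.
    by apply/funext => x; rewrite scale1r addrC.
  exact: smooth_flat.
- apply: (@Ck_on_compR _ _ _ _ _ setT (flat 0) (fun x => b - x)) => //; try exact: openT.
    have := @smooth_affine b (- 1) k; congr Ck_on.
    by apply/funext => x; rewrite scaleN1r.
  exact: smooth_flat.
Qed.
End Bump.

(** * Curvature tensors of constant sectional curvature *)

Section ConstantCurvatureAlgebra.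
Variables (R : realType) (V : lmodType R) (r : V -> V -> V -> V -> R)
  (g : V -> V -> R) (c : R).
Hypotheses (r_linear : forall u v w x a b,
    r u v w (x *: a + b) = x * r u v w a + r u v w b)
  (r_skew12 : forall u v w z, r u v w z = - r v u w z)
  (r_skew34 : forall u v w z, r u v w z = - r u v z w)
  (r_bianchi : forall u v w z, r u v w z + r v w u z + r w u v z = 0)
  (g_linear : forall x a b w, g (x *: a + b) w = x * g a w + g b w)
  (g_sym : forall u v, g u v = g v u)
  (r_sectional : forall u v, r u v v u = c * (g u u * g v v - g u v ^+ 2)).

(** The deviation of r from the model tensor of curvature c. It inherits the symmetries of r and
    vanishes on sectional arguments; the goal is to show that it is zero. *)
Let b u v w z := r u v w z - c * (g v w * g u z - g u w * g v z).

Let gD u v w : g (u + v) w = g u w + g v w.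
Proof. by have := g_linear 1 u v w; rewrite scale1r mul1r. Qed.

Let b_skew12 u v w z : b u v w z = - b v u w z.
Proof. by rewrite /b r_skew12; ring. Qed.

Let b_skew34 u v w z : b u v w z = - b u v z w.
Proof. by rewrite /b r_skew34; ring. Qed.

Let b_bianchi u v w z : b u v w z + b v w u z + b w u v z = 0.
Proof.
rewrite /b; have := r_bianchi u v w z.
rewrite (g_sym v w) (g_sym u w) (g_sym u v); move=> e.
rewrite -[RHS]e; ring.
Qed.

(** A linear combination of the four Bianchi identities obtained by rotating u, v, w, z, with the
    skewness relations that match their terms. Linearity is assumed in the last slot only:
    [b_skew34] moves it to the third, and pair symmetry to the first two. *)
Let b_pair u v w z : b u v w z = b w z u v.
Proof.
have e1 := b_bianchi u v w z; have e2 := b_bianchi v w z u.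
have e3 := b_bianchi w z u v; have e4 := b_bianchi z u v w.
have s1 := b_skew34 v w z u.
have s2 := b_skew34 z v w u; have s2' := b_skew12 z v u w.
have s3 := b_skew34 w z v u; have s4 := b_skew34 z u w v.
have s5 := b_skew34 u w v z; have s5' := b_skew12 w u z v.
have s6 := b_skew34 u v z w; have s7 := b_skew12 u w z v.
have s8 := b_skew34 w u z v. have s9 := b_skew34 v z u w. have s10 := b_skew12 v z u w.
lra.
Qed.

Let b_add4 u v w z z' : b u v w (z + z') = b u v w z + b u v w z'.
Proof.
rewrite /b (g_sym u (z + z')) (g_sym v (z + z')) !gD.
have := r_linear u v w 1 z z'; rewrite scale1r mul1r => ->.
rewrite (g_sym z u) (g_sym z v) (g_sym z' u) (g_sym z' v); ring.
Qed.

Let b_add3 u v w w' z : b u v (w + w') z = b u v w z + b u v w' z.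
Proof. by rewrite b_skew34 b_add4 opprD -!b_skew34. Qed.

Let b_add1 u u' v w z : b (u + u') v w z = b u v w z + b u' v w z.
Proof. by rewrite b_pair b_add3 -!(b_pair w z). Qed.

Let b_add2 u v v' w z : b u (v + v') w z = b u v w z + b u v' w z.
Proof. by rewrite b_pair b_add4 -!(b_pair w z). Qed.

Let b_sectional u v : b u v v u = 0.
Proof. by rewrite /b r_sectional (g_sym v u); ring. Qed.

(** Polarization of b u v v u = 0 in v; the two cross terms agree by the symmetries of b. *)
Let b_polar u v w : b u v w u = 0.
Proof.
have := b_sectional u (v + w); rewrite b_add2 !b_add3 !b_sectional.
have : b u w v u = b u v w u by rewrite b_pair b_skew12 b_skew34 opprK.
lra.
Qed.

(** Polarization of [b_polar] in its repeated outer argument. *)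
Let b_skew23 u v w z : b u v w z = - b u w v z.
Proof.
have := b_polar (u + z) v w; rewrite b_add1 !b_add4 !b_polar.
have : b z v w u = b u w v z by rewrite b_pair b_skew12 b_skew34 opprK.
lra.
Qed.

(** Now b changes sign under swaps of slots 1, 2 and of slots 2, 3, hence is invariant under cyclic
    permutations of the first three; Bianchi then reads 3 b = 0. *)
Lemma constant_curvature_algebra u v w z :
  r u v w z = c * (g v w * g u z - g u w * g v z).
Proof.
apply/eqP; rewrite -subr_eq0; apply/eqP; rewrite -/(b u v w z).
have := b_bianchi u v w z.
have : b v w u z = b u v w z by rewrite b_skew23 -b_skew12.
have : b w u v z = b u v w z by rewrite b_skew12 -b_skew23.
lra.
Qed.

End ConstantCurvatureAlgebra.

Section DiffPointwise.
Variables (R : realType) (U V W : normedModType R).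

Lemma near_eq_diff_app (f g : V -> W) x v : (\near x, f x = g x) -> differentiable f x ->
  'd g x v = 'd f x v.
Proof. by move=> fg df; have [_ ->] := near_eq_diff fg df. Qed.

Lemma diff_comp_app (f : U -> V) (g : V -> W) x y v : f x = y ->
  differentiable f x -> differentiable g y -> 'd (g \o f) x v = 'd g y ('d f x v).
Proof. by move=> <- df dg; rewrite diff_comp. Qed.

End DiffPointwise.

(** * Vector fields in charts *)

Section Charts.
Variables (R : realType) (M : manifold3 R).
Implicit Types (a b c : atlas M) (p q : M) (U : set M) (u v : 'rV[R]_3).

Lemma chart_img_open a U : open U -> open (chart a @` (U `&` dom a)).
Proof.
move=> oU; rewrite openE => _ [q [Uq aq] <-]; rewrite /interior.
have cq := @chart_inv_continuous _ M a q aq.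
have n1 : nbhs (chart a q) (chart_inv a @^-1` U).
  by apply: cq; rewrite chartK//; exact: open_nbhs_nbhs.
have n2 : nbhs (chart a q) (chart a @` dom a).
  by apply: open_nbhs_nbhs; split; [exact: chart_open|exists q].
apply: filterS (filterI n1 n2) => x [/= Ux [q' aq' qx]].
by exists q' => //; split => //; move: Ux; rewrite -qx chartK.
Qed.

Lemma near_chart_inv a p U : open U -> U p -> dom a p ->
  \forall x \near chart a p, exists q, [/\ U q, dom a q & x = chart a q].
Proof.
move=> oU Up ap.
have : nbhs (chart a p) (chart a @` (U `&` dom a)).
  by apply: open_nbhs_nbhs; split; [exact: chart_img_open|exists p].
by apply: filterS => x [q [Uq aq] <-]; exists q.
Qed.

Lemma dom_setI_open a b : open (dom a `&` dom b).
Proof. by apply: openI; exact: dom_open. Qed.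

Lemma trans_open a b : open (chart a @` (dom a `&` dom b)).
Proof. by rewrite setIC; apply: chart_img_open; exact: dom_open. Qed.

Lemma trans_differentiable a b p : dom a p -> dom b p ->
  differentiable (chart b \o chart_inv a) (chart a p).
Proof. by move=> ap bp; apply: (transition_smooth a b 1).1; exists p. Qed.

(** Near [chart a p] the two coordinate expressions of F differ by the transition map. W is
    arbitrary because F is used as a chart, as a function, and as a derivative of a transition
    map. *)
Lemma trans_comp (W : normedModType R) a b p (F : M -> W) v : dom a p -> dom b p ->
  differentiable (F \o chart_inv b) (chart b p) ->
  differentiable (F \o chart_inv a) (chart a p) /\
  'd (F \o chart_inv a) (chart a p) v =
  'd (F \o chart_inv b) (chart b p) ('d (chart b \o chart_inv a) (chart a p) v).
Proof.
move=> ap bp dF.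
have e : (chart b \o chart_inv a) (chart a p) = chart b p by rewrite /= chartK.
have nE : \forall x \near chart a p,
    ((F \o chart_inv b) \o (chart b \o chart_inv a)) x = (F \o chart_inv a) x.
  apply: filterS (near_chart_inv (dom_open b) bp ap) => _ [q [bq aq ->]] /=.
  by rewrite (chartK aq) (chartK bq).
have dT := trans_differentiable ap bp.
have dF' : differentiable (F \o chart_inv b) ((chart b \o chart_inv a) (chart a p)).
  by rewrite e.
split; first exact: near_eq_differentiable nE (differentiable_comp dT dF').
apply: etrans (near_eq_diff_app v nE (differentiable_comp dT dF')) _.
exact: diff_comp_app e dT dF.
Qed.

Lemma trans_id a p v : dom a p -> 'd (chart a \o chart_inv a) (chart a p) v = v.
Proof.
move=> ap.
have nE : \forall x \near chart a p, id x = (chart a \o chart_inv a) x.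
  by apply: filterS (near_chart_inv (dom_open a) ap ap) => _ [q [_ aq ->]] /=;
    rewrite chartK.
have [|_ ->] := near_eq_diff nE; first exact: ex_diff.
by rewrite diff_val.
Qed.

Lemma trans_cancel a b p v : dom a p -> dom b p ->
  'd (chart a \o chart_inv b) (chart b p) ('d (chart b \o chart_inv a) (chart a p) v) = v.
Proof.
move=> ap bp; have [_ <-] := trans_comp v ap bp (trans_differentiable bp ap).
exact: trans_id.
Qed.

(** For u a basis vector this is convertible to [coord_field]; allowing any constant components
    makes it linear in u. *)
Definition chart_field a u p : 'rV[R]_3 :=
  'd (chart (chart_at p) \o chart_inv a) (chart a p) u.

Lemma tcoordK a p v : dom a p -> chart_field a (tcoord a p v) p = v.
Proof. by move=> ap; apply: trans_cancel => //; exact: dom_chart_at. Qed.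

Lemma chart_fieldK a p u : dom a p -> tcoord a p (chart_field a u p) = u.
Proof. by move=> ap; apply: trans_cancel => //; exact: dom_chart_at. Qed.

Lemma tcoord_chart_field a b p u : dom a p -> dom b p ->
  tcoord b p (chart_field a u p) = 'd (chart b \o chart_inv a) (chart a p) u.
Proof.
move=> ap bp; have cp := dom_chart_at p.
by have [_ ->] := trans_comp u ap cp (trans_differentiable cp bp).
Qed.

Lemma tcoord_at p v : tcoord (chart_at p) p v = v.
Proof. exact: trans_id (dom_chart_at p). Qed.

Lemma chart_field_at p u : chart_field (chart_at p) u p = u.
Proof. exact: trans_id (dom_chart_at p). Qed.

Lemma chart_fieldP a p (x : R) u v :
  chart_field a (x *: u + v) p = x *: chart_field a u p + chart_field a v p.
Proof. exact: linearP. Qed.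

Lemma chart_field_sum a p v :
  chart_field a v p = \sum_(i < 3) v 0 i *: chart_field a (delta_mx 0 i) p.
Proof.
by rewrite /chart_field {1}(row_sum_delta v) linear_sum; apply: eq_bigr => i _;
  rewrite linearZ.
Qed.

(** Reduces smoothness, which quantifies over all charts, to a single chart containing U. *)
Lemma smooth_change (W : normedModType R) a b U (F : M -> W) : open U -> U `<=` dom a ->
  smooth_on (chart a @` U) (F \o chart_inv a) ->
  smooth_on (chart b @` (U `&` dom b)) (F \o chart_inv b).
Proof.
move=> oU Ua CF k.
have oI := @chart_img_open b _ oU.
have oA : open (chart a @` U) by have := @chart_img_open a _ oU; rewrite setIidl.
apply: (@Ck_on_eq _ _ _ _ _ (fun x => (F \o chart_inv a) ((chart a \o chart_inv b) x))) => //.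
  by move=> _ [q [Uq bq] <-] /=; rewrite (chartK bq) chartK//; exact: Ua.
apply: (@Ck_on_comp _ _ _ _ _ _ (chart a @` U)) => //.
- by move=> _ [q [Uq bq] <-] /=; exists q => //; rewrite chartK.
- apply: Ck_on_sub (transition_smooth b a k) => _ [q [Uq bq] <-].
  by exists q => //; split => //; exact: Ua.
Qed.

Lemma smooth_fun_of_chart a U (f : M -> R) : open U -> U `<=` dom a ->
  smooth_on (chart a @` U) (f \o chart_inv a) -> smooth_fun U f.
Proof. by move=> oU Ua Cf b; exact: smooth_change Cf. Qed.

(** In a chart b its components are the derivative along u of the transition map from a to b, a
    smooth function of the a-coordinates. *)
Lemma smooth_vf_chart_field a u : smooth_vf (dom a) (chart_field a u).
Proof.
move=> b.
have oU := dom_setI_open a b.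
have oA := @trans_open a b.
have := @smooth_change _ a b (dom a `&` dom b)
  (fun q => 'd (chart b \o chart_inv a) (chart a q) u) oU.
have -> : dom a `&` dom b `&` dom b = dom a `&` dom b by rewrite -setIA setIid.
move=> C k; have {}C := C (@subIsetl _ _ _) _ k.
apply: (Ck_on_eq _ _ (C _)).
- by apply: chart_img_open; exact: dom_open.
- move=> _ [q [aq bq] <-]; rewrite /local_field /= (chartK bq).
  by rewrite tcoord_chart_field.
- move=> k'; have Cd := @Ck_on_d _ _ _ k' _ _ u oA (transition_smooth a b k'.+1).
  apply: (Ck_on_eq oA _ Cd).
  by move=> _ [q [aq bq] <-]; rewrite /comp (chartK aq).
Qed.

Lemma local_fieldZ a (f : M -> R) X x :
  local_field a (fun q => f q *: X q) x = f (chart_inv a x) *: local_field a X x.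
Proof. exact: linearZ. Qed.

Lemma local_fieldD a (X Y : M -> 'rV[R]_3) x :
  local_field a (fun q => X q + Y q) x = local_field a X x + local_field a Y x.
Proof. exact: linearD. Qed.

Lemma smooth_vfZ U f (X : M -> 'rV[R]_3) : open U -> smooth_fun U f -> smooth_vf U X ->
  smooth_vf U (fun q => f q *: X q).
Proof.
move=> oU Cf CX a k; have oI := @chart_img_open a _ oU.
apply: (Ck_on_eq oI _ (Ck_onZ oI (Cf a k) (CX a k))) => x _.
by rewrite local_fieldZ.
Qed.

Lemma smooth_vfD U (X Y : M -> 'rV[R]_3) : open U -> smooth_vf U X -> smooth_vf U Y ->
  smooth_vf U (fun q => X q + Y q).
Proof.
move=> oU CX CY a k; have oI := @chart_img_open a _ oU.
apply: (Ck_on_eq oI _ (Ck_onD oI (CX a k) (CY a k))) => x _.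
by rewrite local_fieldD.
Qed.

Lemma smooth_vf0 U : smooth_vf U (fun=> 0).
Proof.
move=> a k; rewrite (_ : local_field a _ = cst 0); first exact: Ck_on_cst.
by apply/funext => x; rewrite /local_field /tcoord linear0.
Qed.

Lemma smooth_vf_sum U n (X : 'I_n -> M -> 'rV[R]_3) : open U ->
  (forall i, smooth_vf U (X i)) -> smooth_vf U (fun q => \sum_(i < n) X i q).
Proof.
move=> oU; elim: n X => [|n IH] X CX.
  rewrite (_ : (fun q => _) = fun=> 0); first exact: smooth_vf0.
  by apply/funext => q; rewrite big_ord0.
rewrite (_ : (fun q => _) = fun q => \sum_(i < n) X (widen_ord (leqnSn n) i) q + X ord_max q).
  by apply: smooth_vfD => //; exact: IH.
by apply/funext => q; rewrite big_ord_recr.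
Qed.

Lemma smooth_vf_sub U V (X : M -> 'rV[R]_3) : V `<=` U -> smooth_vf U X -> smooth_vf V X.
Proof.
move=> VU CX a k; apply: Ck_on_sub (CX a k) => _ [q [Vq aq] <-].
by exists q => //; split => //; exact: VU.
Qed.

Lemma smooth_fun_cst U (x : R) : smooth_fun U (fun=> x).
Proof. by move=> a k; exact: Ck_on_cst. Qed.

Lemma smooth_fun_tcoord a U (X : M -> 'rV[R]_3) i : open U -> U `<=` dom a ->
  smooth_vf U X -> smooth_fun U (fun q => (tcoord a q (X q)) 0 i).
Proof.
move=> oU Ua CX; apply: (smooth_fun_of_chart oU Ua) => k.
have := CX a; rewrite setIidl// => {}CX.
by apply: (Ck_on_coord i _ (CX k)); rewrite -(setIidl Ua); exact: chart_img_open.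
Qed.

Lemma dirder_chart a U p v f : open U -> U p -> dom a p -> smooth_fun U f ->
  dirder p v f = 'd (f \o chart_inv a) (chart a p) (tcoord a p v).
Proof.
move=> oU Up ap Cf; have cp := dom_chart_at p.
have df : differentiable (f \o chart_inv a) (chart a p) by apply: (Cf a 1).1; exists p.
have [dfc dE] := trans_comp v cp ap df.
by rewrite /dirder deriveE// dE.
Qed.

Lemma dirder_chart_field a U p u f : open U -> U p -> dom a p -> smooth_fun U f ->
  dirder p (chart_field a u p) f = 'D_u (f \o chart_inv a) (chart a p).
Proof.
move=> oU Up ap Cf; rewrite (dirder_chart _ oU Up ap Cf) chart_fieldK// deriveE//.
by apply: (Cf a 1).1; exists p.
Qed.

(** [lie] is computed in [chart_at p], where the components of the two fields are first derivatives
    of one transition map. The bracket is therefore a commutator of second derivatives. *)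
Lemma lie_chart_field a p u v : dom a p -> lie (chart_field a u) (chart_field a v) p = 0.
Proof.
move=> ap; have cp := dom_chart_at p.
pose t := chart (chart_at p) \o chart_inv a.
have Ct := transition_smooth a (chart_at p).
have aux w z : 'D_(chart_field a w p) (local_field (chart_at p) (chart_field a z))
    (chart (chart_at p) p) = 'D_w ('D_z t) (chart a p).
  pose F q := 'D_z t (chart a q).
  have nE : \forall x \near chart (chart_at p) p,
     (F \o chart_inv (chart_at p)) x = local_field (chart_at p) (chart_field a z) x.
    apply: filterS (near_chart_inv (dom_open a) ap cp) => _ [q [aq cq ->]] /=.
    rewrite /F /local_field (chartK cq) tcoord_chart_field// deriveE//.
    exact: trans_differentiable.
  have nE' : \forall x \near chart a p, 'D_z t x = (F \o chart_inv a) x.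
    apply: filterS (near_chart_inv (dom_open a) ap ap) => _ [q [_ aq ->]] /=.
    by rewrite /F (chartK aq).
  have dD : differentiable ('D_z t) (chart a p) by apply: ((Ct 2).2 z).1; exists p.
  have dFa := near_eq_differentiable nE' dD.
  have [dFc dFcE] := trans_comp (chart_field a w p) cp ap dFa.
  apply: etrans (esym (near_eq_derive _ nE)) _.
  apply: etrans (deriveE _ dFc) _; apply: etrans dFcE _.
  apply: etrans (near_eq_diff_app _ nE' dD) _.
  apply: etrans _ (esym (deriveE _ dD)); congr ('d _ _ _).
  exact: chart_fieldK.
rewrite /lie !aux; apply/eqP; rewrite subr_eq0; apply/eqP.
by apply: (schwarz _ _ (@trans_open a (chart_at p)) (Ct 2)); exists p.
Qed.

End Charts.

(** * The Levi-Civita connection in a chart *)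

Section MetricLinear.
Variables (R : realType) (M : manifold3 R) (h : metric M) (p : M).

Lemma mvalDl u v w : h p (u + v) w = h p u w + h p v w.
Proof. by have := metric_linear h p 1 u v w; rewrite scale1r mul1r. Qed.

Lemma mval0l w : h p 0 w = 0.
Proof. by have := mvalDl 0 0 w; rewrite addr0 => /eqP; rewrite -subr_eq subrr => /eqP. Qed.

Lemma mvalZl x u w : h p (x *: u) w = x * h p u w.
Proof. by have := metric_linear h p x u 0 w; rewrite addr0 mval0l addr0. Qed.

Lemma mvalNl u w : h p (- u) w = - h p u w.
Proof. by rewrite -scaleN1r mvalZl mulN1r. Qed.

Lemma mvalBl u v w : h p (u - v) w = h p u w - h p v w.
Proof. by rewrite mvalDl mvalNl. Qed.

Lemma mvalDr u v w : h p w (u + v) = h p w u + h p w v.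
Proof. by rewrite Defs.metric_sym mvalDl !(Defs.metric_sym h p w). Qed.

Lemma mvalZr x u w : h p w (x *: u) = x * h p w u.
Proof. by rewrite Defs.metric_sym mvalZl (Defs.metric_sym h p w). Qed.

Lemma mval0r w : h p w 0 = 0.
Proof. by rewrite Defs.metric_sym mval0l. Qed.

Lemma mvalNr u w : h p w (- u) = - h p w u.
Proof. by rewrite Defs.metric_sym mvalNl (Defs.metric_sym h p w). Qed.

Lemma mvalBr u v w : h p w (u - v) = h p w u - h p w v.
Proof. by rewrite mvalDr mvalNr. Qed.

Lemma mval_suml n (f : 'I_n -> 'rV[R]_3) w :
  h p (\sum_(i < n) f i) w = \sum_(i < n) h p (f i) w.
Proof.
by elim/big_ind2: _ => [|x1 x2 y1 y2 <- <-|//]; [rewrite mval0l|rewrite mvalDl].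
Qed.

Lemma mval_eq0 u : h p u u = 0 -> u = 0.
Proof.
move=> h0; apply/eqP/negPn/negP => /(metric_pos h p); by rewrite h0 ltxx.
Qed.

End MetricLinear.

Section Connection.
Variables (R : realType) (M : manifold3 R) (h : metric M)
  (D : M -> 'rV[R]_3 -> (M -> 'rV[R]_3) -> 'rV[R]_3).
Hypothesis hLC : levi_civita h D.
Implicit Types (p q : M) (U : set M) (X Y Z W : M -> 'rV[R]_3).

Let hD : affine_connection D := lc_connection hLC.

(* The Leibniz rule for the indicator function of U makes D local. *)
Lemma conn_eq U p v X Y : open U -> U p -> smooth_vf U X ->
  (forall q, U q -> X q = Y q) -> D p v X = D p v Y.
Proof.
move=> oU Up CX XY.
pose f q : R := if `[< U q >] then 1 else 0.
have fU q : U q -> f q = 1 by move=> Uq; rewrite /f asboolT.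
have fXY : (fun q => f q *: X q) = (fun q => f q *: Y q).
  apply/funext => q; rewrite /f; case: asboolP => [/XY ->//|_].
  by rewrite !scale0r.
have Cf : smooth_fun U f.
  move=> a k; apply: (Ck_on_eq _ _ (Ck_on_cst k _ (1 : R))).
    exact: chart_img_open.
  by move=> _ [q [Uq aq] <-]; rewrite /= (chartK aq) fU.
have df0 : dirder p v f = 0.
  rewrite (dirder_chart v oU Up (dom_chart_at p) Cf) -deriveE; last first.
    by apply: (Cf _ 1).1; exists p => //; split => //; exact: dom_chart_at.
  rewrite -[RHS](derive_cst (1:R) (chart (chart_at p) p) (tcoord (chart_at p) p v)).
  apply: near_eq_derive.
  apply: filterS (near_chart_inv oU Up (dom_chart_at p)) => _ [q [Uq aq ->]].
  by rewrite /= (chartK aq) fU.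
have CY : smooth_vf U Y.
  move=> a k; apply: (Ck_on_eq _ _ (CX a k)); first exact: chart_img_open.
  by move=> _ [q [Uq aq] <-]; rewrite /local_field (chartK aq) XY.
have := conn_leibniz hD oU Up Cf CX v; rewrite fXY (conn_leibniz hD oU Up Cf CY v).
by rewrite df0 fU// !scale0r !scale1r !add0r => ->.
Qed.

Lemma conn0 U p X : open U -> U p -> smooth_vf U X -> D p 0 X = 0.
Proof.
move=> oU Up CX; have := conn_linear hD oU Up CX 1 0 0.
rewrite !scale1r addr0 => /eqP; by rewrite -subr_eq subrr => /eqP.
Qed.

Lemma conn_zero p v : D p v (fun=> 0) = 0.
Proof.
have := conn_add hD openT (I : setT p) (@smooth_vf0 _ _ _) (@smooth_vf0 _ _ _) v.
rewrite (_ : (fun q => _) = fun=> 0); last by apply/funext => q; rewrite addr0.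
by move=> /eqP; rewrite -subr_eq subrr => /eqP.
Qed.

Lemma conn_sum U p v n (f : 'I_n -> M -> R) (X : 'I_n -> M -> 'rV[R]_3) :
  open U -> U p -> (forall i, smooth_fun U (f i)) -> (forall i, smooth_vf U (X i)) ->
  D p v (fun q => \sum_(i < n) f i q *: X i q) =
  \sum_(i < n) (dirder p v (f i) *: X i p + f i p *: D p v (X i)).
Proof.
move=> oU Up; elim: n f X => [|n IH] f X Cf CX.
  rewrite big_ord0 -[RHS](conn_zero p v); congr (D p v _).
  by apply/funext => q; rewrite big_ord0.
rewrite big_ord_recr /= -(conn_leibniz hD oU Up)// -IH//.
rewrite -(conn_add hD oU Up); last 2 first.
- by apply: smooth_vf_sum => // i; exact: smooth_vfZ.
- exact: smooth_vfZ.
by congr (D p v _); apply/funext => q; rewrite big_ord_recr.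
Qed.

Section InChart.
Variable a : atlas M.
Notation E := (chart_field a).

Let oa : open (dom a) := dom_open a.

Definition conn_chart u Z q := D q (E u q) Z.

Lemma smooth_conn_chart u Z : smooth_vf (dom a) Z -> smooth_vf (dom a) (conn_chart u Z).
Proof. by move=> CZ; apply: (conn_smooth hD) => //; exact: smooth_vf_chart_field. Qed.

Lemma conn_chartP p x u v Z : dom a p -> smooth_vf (dom a) Z ->
  conn_chart (x *: u + v) Z p = x *: conn_chart u Z p + conn_chart v Z p.
Proof.
by move=> ap CZ; rewrite /conn_chart chart_fieldP (conn_linear hD oa ap CZ).
Qed.

Lemma conn_chartZ p x u Z : dom a p -> smooth_vf (dom a) Z ->
  conn_chart (x *: u) Z p = x *: conn_chart u Z p.
Proof.
move=> ap CZ; rewrite -[x *: u]addr0 conn_chartP// /conn_chart.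
by rewrite [E 0 p](linear0 _) (conn0 oa ap CZ) addr0.
Qed.

Lemma conn_chart_sum p u Z : dom a p -> smooth_vf (dom a) Z ->
  conn_chart u Z p = \sum_(i < 3) u 0 i *: conn_chart (delta_mx 0 i) Z p.
Proof.
move=> ap CZ; rewrite {1}(row_sum_delta u) !big_ord_recr !big_ord0 /= !add0r.
rewrite -[in RHS]addrA -[in LHS]addrA !conn_chartP// conn_chartZ//.
Qed.

Lemma chart_torsion_free p u v : dom a p ->
  conn_chart u (E v) p = conn_chart v (E u) p.
Proof.
move=> ap; apply/eqP; rewrite -subr_eq0.
rewrite [X in X == _](lc_torsion_free hLC oa ap); try exact: smooth_vf_chart_field.
by rewrite lie_chart_field.
Qed.

Definition mval_chart Z W x := h (chart_inv a x) (Z (chart_inv a x)) (W (chart_inv a x)).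

Lemma mval_chartE Z W q : dom a q -> mval_chart Z W (chart a q) = h q (Z q) (W q).
Proof. by move=> aq; rewrite /mval_chart (chartK aq). Qed.

Lemma smooth_mval_chart Z W : smooth_vf (dom a) Z -> smooth_vf (dom a) W ->
  smooth_on (chart a @` dom a) (mval_chart Z W).
Proof.
by move=> CZ CW; have := metric_smooth h oa CZ CW a; rewrite setIid.
Qed.

Lemma derive_mval_chart p u Z W : dom a p -> smooth_vf (dom a) Z -> smooth_vf (dom a) W ->
  'D_u (mval_chart Z W) (chart a p) =
  h p (conn_chart u Z p) (W p) + h p (Z p) (conn_chart u W p).
Proof.
move=> ap CZ CW; rewrite -(lc_metric hLC oa ap CZ CW).
by rewrite (dirder_chart_field u oa ap ap (metric_smooth h oa CZ CW)).
Qed.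

(** The curvature R(u, v) Z for constant-component fields, whose bracket term vanishes. *)
Definition curv u v Z q :=
  conn_chart u (conn_chart v Z) q - conn_chart v (conn_chart u Z) q.

Lemma curvature_chart u v Z p : dom a p -> smooth_vf (dom a) Z ->
  curvature D (E u) (E v) Z p = curv u v Z p.
Proof.
by move=> ap CZ; rewrite /curvature lie_chart_field// (conn0 oa ap CZ) subr0.
Qed.

(* Metric compatibility turns skewness in the last two slots into the symmetry
   of the second derivatives of h(Z, W). *)
Lemma curv_skew u v Z W p : dom a p -> smooth_vf (dom a) Z -> smooth_vf (dom a) W ->
  h p (curv u v Z p) (W p) = - h p (Z p) (curv u v W p).
Proof.
move=> ap CZ CW.
have dd w z : 'D_w ('D_z (mval_chart Z W)) (chart a p) =
    (h p (conn_chart w (conn_chart z Z) p) (W p) +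
     h p (conn_chart z Z p) (conn_chart w W p)) +
    (h p (conn_chart w Z p) (conn_chart z W p) +
     h p (Z p) (conn_chart w (conn_chart z W) p)).
  have CzZ := smooth_conn_chart z CZ; have CzW := smooth_conn_chart z CW.
  have d1 : differentiable (mval_chart (conn_chart z Z) W) (chart a p).
    by apply: (smooth_mval_chart CzZ CW 1).1; exists p.
  have d2 : differentiable (mval_chart Z (conn_chart z W)) (chart a p).
    by apply: (smooth_mval_chart CZ CzW 1).1; exists p.
  rewrite -(derive_mval_chart w ap CzZ CW) -(derive_mval_chart w ap CZ CzW).
  rewrite -deriveD; try exact: diff_derivable.
  apply: near_eq_derive.
  apply: filterS (near_chart_inv oa ap ap) => _ [q [_ aq ->]].
  apply: etrans (derive_mval_chart z aq CZ CW) _.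
  by rewrite -!(mval_chartE _ _ aq).
have := schwarz_real u v (@chart_open _ _ a) (smooth_mval_chart CZ CW 2) (ex_intro2 _ _ p ap erefl).
rewrite !dd /curv mvalBl mvalBr; lra.
Qed.

(** Torsion-freeness exchanges the two inner fields in each second derivative, after which the six
    terms cancel in pairs. *)
Lemma curv_bianchi u v w p : dom a p ->
  curv u v (E w) p + curv v w (E u) p + curv w u (E v) p = 0.
Proof.
move=> ap.
have tf x y z : conn_chart x (conn_chart y (E z)) p = conn_chart x (conn_chart z (E y)) p.
  apply: (conn_eq _ oa ap).
    exact/smooth_conn_chart/smooth_vf_chart_field.
  by move=> q aq; exact: chart_torsion_free.
rewrite /curv (tf u w v) (tf v u w) (tf w v u).
set A := conn_chart u _ p; set B := conn_chart v _ p; set C := conn_chart w _ p.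
by rewrite !addrA !subrK subrr.
Qed.

End InChart.

(** The pointwise algebra is applied to constant-component fields. As sectional curvature is a
    quotient, the hypothesis says nothing about dependent vectors; there both sides are shown to
    vanish. *)
Lemma constant_curvature_chart c a u v w z p : constant_curvature h D c -> dom a p ->
  h p (curv a u v (chart_field a w) p) (chart_field a z p) =
  c * (h p (chart_field a v p) (chart_field a w p) *
       h p (chart_field a u p) (chart_field a z p) -
       h p (chart_field a u p) (chart_field a w p) *
       h p (chart_field a v p) (chart_field a z p)).
Proof.
move=> hc ap; have oa := dom_open a; have CE := @smooth_vf_chart_field _ _ a.
pose g u v := h p (chart_field a u p) (chart_field a v p).
pose r u v w z := h p (curv a u v (chart_field a w) p) (chart_field a z p).
have rl u' v' w' x a' b : r u' v' w' (x *: a' + b) = x * r u' v' w' a' + r u' v' w' b.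
  by rewrite /r chart_fieldP mvalDr mvalZr.
have s12 u' v' w' z' : r u' v' w' z' = - r v' u' w' z'.
  by rewrite /r -mvalNl /curv opprB.
have s34 u' v' w' z' : r u' v' w' z' = - r u' v' z' w'.
  by rewrite /r curv_skew// Defs.metric_sym.
have bi u' v' w' z' : r u' v' w' z' + r v' w' u' z' + r w' u' v' z' = 0.
  by rewrite /r -!mvalDl curv_bianchi// mval0l.
have gl x a' b w' : g (x *: a' + b) w' = x * g a' w' + g b w'.
  by rewrite /g chart_fieldP mvalDl mvalZl.
have gs u' v' : g u' v' = g v' u' by exact: Defs.metric_sym.
apply: (@constant_curvature_algebra _ _ r g c rl s12 s34 bi gl gs) => {w z} u' v'.
have [g0|g0] := eqVneq (g u' u' * g v' v' - g u' v' ^+ 2) 0; last first.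
  have := hc _ _ _ _ oa ap (CE u') (CE v') g0.
  rewrite /sectional_curvature curvature_chart//.
  by move/(canRL (divfK g0)).
rewrite g0 mulr0.
have [v0|v0] := eqVneq (chart_field a v' p) 0.
  by rewrite s34 /r v0 mval0r oppr0.
have gv : 0 < g v' v' by exact: metric_pos.
(* Equality in Cauchy-Schwarz: the squared norm of the difference is g v' v' times the Gram
   determinant, which is zero. *)
have e : g v' v' *: chart_field a u' p = g u' v' *: chart_field a v' p.
  apply/eqP; rewrite -subr_eq0; apply/eqP/(@mval_eq0 _ _ h p).
  rewrite mvalBl !mvalBr !mvalZl !mvalZr -/(g u' u') -/(g u' v') -/(g v' u') -/(g v' v').
  by rewrite (gs v' u') -[RHS](mulr0 (g v' v')) -g0; ring.
have : g v' v' * r u' v' v' u' = 0.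
  by rewrite /r -mvalZr e mvalZr -/(r u' v' v' v') (_ : r u' v' v' v' = 0) ?mulr0//;
    have := s34 u' v' v' v'; lra.
by move/eqP; rewrite mulf_eq0 (gt_eqF gv) => /eqP.
Qed.

End Connection.

(** * Covariant differentiation along maps *)

Section Derive1.
Variables (R : realType) (W : normedModType R).
Implicit Types f g : R -> W.

Lemma near_eq_derive1 f g t : (\near t, f t = g t) -> derive1 f t = derive1 g t.
Proof. by move=> fg; rewrite !derive1E; exact: near_eq_derive. Qed.

Lemma derive1D f g t : differentiable f t -> differentiable g t ->
  derive1 (fun s => f s + g s) t = derive1 f t + derive1 g t.
Proof.
by move=> df dg; rewrite !derive1E -deriveD//; exact: diff_derivable.
Qed.

Lemma derive1Z (f : R -> R) g t : differentiable f t -> differentiable g t ->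
  derive1 (fun s => f s *: g s) t = derive1 f t *: g t + f t *: derive1 g t.
Proof.
move=> df dg; have [dfg E] := differentiable_scale df dg.
by rewrite !derive1E !deriveE// E.
Qed.

End Derive1.

Section TcoordLinear.
Variables (R : realType) (M : manifold3 R) (a : atlas M) (p : M).

Lemma tcoordD u v : tcoord a p (u + v) = tcoord a p u + tcoord a p v.
Proof. exact: linearD. Qed.

Lemma tcoordZ x v : tcoord a p (x *: v) = x *: tcoord a p v.
Proof. exact: linearZ. Qed.

End TcoordLinear.

Section Curves.
Variables (R : realType) (M : manifold3 R) (h : metric M)
  (D : M -> 'rV[R]_3 -> (M -> 'rV[R]_3) -> 'rV[R]_3).
Hypothesis hLC : levi_civita h D.
Implicit Types (p q : M) (U : set M) (X Y Z W : M -> 'rV[R]_3) (gam : R -> M).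

Let hD : affine_connection D := lc_connection hLC.

Lemma near_dom a (V : normedModType R) (F : V -> M) z : {for z, continuous F} -> dom a (F z) ->
  \forall x \near z, dom a (F x).
Proof. by move=> cF aF; apply: cF; apply: open_nbhs_nbhs; split => //; exact: dom_open. Qed.

Lemma velocity_chart a gam t : {for t, continuous gam} -> dom a (gam t) ->
  differentiable (chart a \o gam) t ->
  velocity gam t = chart_field a (derive1 (chart a \o gam) t) (gam t).
Proof.
move=> cg ag dg; set b := chart_at (gam t); have bg : dom b (gam t) := dom_chart_at _.
have dT := trans_differentiable ag bg.
have nE : \forall s \near t,
    ((chart b \o chart_inv a) \o (chart a \o gam)) s = (chart b \o gam) s.
  apply: filterS (near_dom cg ag) => s as_ /=.
  by rewrite (chartK as_).
have dbg : differentiable (chart b \o gam) t.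
  exact: near_eq_differentiable nE (differentiable_comp dg dT).
rewrite /velocity derive1E deriveE// derive1E deriveE//.
apply: etrans (near_eq_diff_app _ nE (differentiable_comp dg dT)) _.
exact: (diff_comp_app _ erefl dg dT).
Qed.

Lemma derive1_coord (n : nat) (f : R -> 'rV[R]_n) t i : differentiable f t ->
  derive1 f t 0 i = derive1 (fun s => f s 0 i) t.
Proof.
move=> df; rewrite !derive1E derive_mx ?mxE//; exact: diff_derivable.
Qed.

(** Compatibility of the pullback connection with [D]: expand X near gam t in coordinate fields. The
    Leibniz rule leaves the derivatives of the components, which the chain rule identifies with
    derivatives along gam. *)
Lemma cov_along_vf U X gam t : open U -> U (gam t) -> smooth_vf U X ->
  {for t, continuous gam} -> differentiable (chart (chart_at (gam t)) \o gam) t ->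
  cov_along D gam (X \o gam) t = D (gam t) (velocity gam t) X.
Proof.
move=> oU Ug CX cg dg; set p := gam t; set a := chart_at p in dg *.
have ap : dom a p := dom_chart_at p.
pose U' := U `&` dom a.
have oU' : open U' by apply: openI => //; exact: dom_open.
have U'p : U' p by split.
have CX' : smooth_vf U' X by apply: smooth_vf_sub CX; exact: subIsetl.
pose f i q := (tcoord a q (X q)) 0 i.
have Cf i : smooth_fun U' (f i).
  by apply: smooth_fun_tcoord CX' => //; exact: subIsetr.
have CE i : smooth_vf U' (chart_field a (delta_mx 0 i)).
  by apply: smooth_vf_sub (smooth_vf_chart_field _ _); exact: subIsetr.
have XE q : U' q -> X q = \sum_(i < 3) f i q *: chart_field a (delta_mx 0 i) q.
  by move=> [_ aq]; rewrite -chart_field_sum tcoordK.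
rewrite (conn_eq hLC (velocity gam t) oU' U'p CX' XE) (conn_sum hLC _ oU' U'p Cf CE).
rewrite big_split /=; congr (_ + _); last first.
  by apply: eq_bigr => i _; rewrite /f tcoord_at.
have dL : differentiable (local_field a X) (chart a p).
  by apply: (CX' a 1).1; exists p.
have nE : \forall s \near t,
    (local_field a X \o (chart a \o gam)) s = tcoord a (gam s) ((X \o gam) s).
  apply: filterS (near_dom cg ap) => s as_.
  by rewrite /comp /local_field (chartK as_).
have dW := near_eq_differentiable nE (differentiable_comp dg dL).
rewrite derive1E deriveE//.
apply: etrans (near_eq_diff_app _ nE (differentiable_comp dg dL)) _.
apply: etrans (diff_comp_app _ erefl dg dL) _.
have -> : 'd (chart a \o gam) t 1 = velocity gam t by rewrite /velocity derive1E deriveE.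
apply/rowP => j; rewrite summxE (bigD1 j)//= big1 ?addr0; last first.
  by move=> i ij; rewrite chart_field_at !mxE eqxx/= eq_sym (negbTE ij) mulr0.
rewrite chart_field_at !mxE !eqxx/= mulr1.
rewrite (dirder_chart _ oU' U'p ap (Cf j)) tcoord_at.
rewrite -!deriveE//; last by apply: (Cf j a 1).1; exists p.
by rewrite derive_mx ?mxE//; exact: diff_derivable.
Qed.

Lemma cov_along_eq gam V V' t : {near t, V =1 V'} -> cov_along D gam V t = cov_along D gam V' t.
Proof.
move=> VV'; have e : V t = V' t by exact: (nbhs_singleton VV').
have e1 : derive1 (fun s => tcoord (chart_at (gam t)) (gam s) (V s)) t =
          derive1 (fun s => tcoord (chart_at (gam t)) (gam s) (V' s)) t.
  by apply: near_eq_derive1; apply: filterS VV' => s ->.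
rewrite /cov_along.
rewrite e1.
rewrite e.
by [].
Qed.

Lemma tcoord_alongZ gam a (f : R -> R) (V : R -> 'rV[R]_3) :
  (fun s => tcoord a (gam s) (f s *: V s)) = (fun s => f s *: tcoord a (gam s) (V s)).
Proof. by apply/funext => s; rewrite tcoordZ. Qed.

Lemma tcoord_alongD gam a (V V' : R -> 'rV[R]_3) :
  (fun s => tcoord a (gam s) (V s + V' s)) =
  (fun s => tcoord a (gam s) (V s) + tcoord a (gam s) (V' s)).
Proof. by apply/funext => s; rewrite tcoordD. Qed.

Lemma differentiable_tcoord_scale gam a (f : R -> R) (V : R -> 'rV[R]_3) t :
  differentiable f t -> differentiable (fun s => tcoord a (gam s) (V s)) t ->
  differentiable (fun s => tcoord a (gam s) (f s *: V s)) t.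
Proof.
by move=> df dV; rewrite tcoord_alongZ; have [dfV _] := differentiable_scale df dV.
Qed.

Lemma differentiable_tcoord_add gam a (V V' : R -> 'rV[R]_3) t :
  differentiable (fun s => tcoord a (gam s) (V s)) t ->
  differentiable (fun s => tcoord a (gam s) (V' s)) t ->
  differentiable (fun s => tcoord a (gam s) (V s + V' s)) t.
Proof. by rewrite tcoord_alongD => dV dV'; exact: differentiableD. Qed.

Lemma cov_alongD gam (V V' : R -> 'rV[R]_3) t :
  differentiable (fun s => tcoord (chart_at (gam t)) (gam s) (V s)) t ->
  differentiable (fun s => tcoord (chart_at (gam t)) (gam s) (V' s)) t ->
  cov_along D gam (fun s => V s + V' s) t = cov_along D gam V t + cov_along D gam V' t.
Proof.
move=> dV dV'; rewrite /cov_along tcoord_alongD (derive1D dV dV').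
rewrite addrACA; congr (_ + _).
by rewrite -big_split /=; apply: eq_bigr => i _; rewrite mxE scalerDl.
Qed.

Lemma cov_alongZ gam (f : R -> R) (V : R -> 'rV[R]_3) t :
  differentiable f t ->
  differentiable (fun s => tcoord (chart_at (gam t)) (gam s) (V s)) t ->
  cov_along D gam (fun s => f s *: V s) t = derive1 f t *: V t + f t *: cov_along D gam V t.
Proof.
move=> df dV; rewrite /cov_along tcoord_alongZ (derive1Z df dV) tcoord_at.
rewrite scalerDr addrA; congr (_ + _).
by rewrite scaler_sumr; apply: eq_bigr => i _; rewrite mxE scalerA.
Qed.

End Curves.

(** * The covariant derivative of xi in chart coordinates *)

Section ConnForm.
Variables (R : realType) (M : manifold3 R) (h : metric M)
  (D : M -> 'rV[R]_3 -> (M -> 'rV[R]_3) -> 'rV[R]_3).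
Hypothesis hLC : levi_civita h D.
Variables (xi : M -> 'rV[R]_3) (hxi : smooth_vf setT xi) (a : atlas M).
Implicit Types (p q : M) (u v w x : 'rV[R]_3).

Let Z u := conn_chart D a u xi.
Let e (i : 'I_3) : 'rV[R]_3 := delta_mx 0 i.

Lemma smooth_dom_xi : smooth_vf (dom a) xi.
Proof. exact: smooth_vf_sub hxi. Qed.

Lemma smooth_conn_chart_xi u : smooth_vf (dom a) (Z u).
Proof. by apply: (smooth_conn_chart hLC); exact: smooth_dom_xi. Qed.

Lemma conn_chart_xi_sum u p : dom a p -> Z u p = \sum_(i < 3) u 0 i *: Z (e i) p.
Proof. by move=> ap; apply: (conn_chart_sum hLC) => //; exact: smooth_dom_xi. Qed.

Lemma conn_conn_chart_sum v u p : dom a p ->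
  D p v (Z u) = \sum_(i < 3) u 0 i *: D p v (Z (e i)).
Proof.
move=> ap; have oa := dom_open a.
rewrite (conn_eq hLC v oa ap (smooth_conn_chart_xi u) (conn_chart_xi_sum u)).
rewrite (@conn_sum _ _ _ _ hLC (dom a) p v 3 (fun i _ => u 0 i) (fun i => Z (e i))) //.
- apply: eq_bigr => i _; rewrite (_ : dirder _ _ _ = 0) ?scale0r ?add0r//.
  exact: derive_cst.
- by move=> i; exact: smooth_fun_cst.
- by move=> i; exact: smooth_conn_chart_xi.
Qed.

Lemma conn_chart_conn_sum v u p : dom a p ->
  conn_chart D a v (Z u) p = \sum_(i < 3) u 0 i *: conn_chart D a v (Z (e i)) p.
Proof. exact: conn_conn_chart_sum. Qed.

Lemma mval_sum_sum p (A B : 'I_3 -> 'rV[R]_3) u w :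
  h p (\sum_(i < 3) u 0 i *: A i) (\sum_(j < 3) w 0 j *: B j) =
  \sum_(i < 3) \sum_(j < 3) u 0 i * w 0 j * h p (A i) (B j).
Proof.
rewrite mval_suml; apply: eq_bigr => i _.
rewrite mvalZl Defs.metric_sym mval_suml mulr_sumr; apply: eq_bigr => j _.
by rewrite mvalZl Defs.metric_sym mulrA.
Qed.

(* h(D_u xi, D_w xi) at the point with coordinates x, expanded in the basis so
   as to be jointly smooth in u, w and x. *)
Definition conn_form u w x : R :=
  \sum_(i < 3) \sum_(j < 3) u 0 i * w 0 j * mval_chart h a (Z (e i)) (Z (e j)) x.

Lemma conn_formE u w q : dom a q -> conn_form u w (chart a q) = h q (Z u q) (Z w q).
Proof.
move=> aq; rewrite (conn_chart_xi_sum u aq) (conn_chart_xi_sum w aq) mval_sum_sum.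
by apply: eq_bigr => i _; apply: eq_bigr => j _; rewrite mval_chartE.
Qed.

Section OnMap.
Variables (V : normedModType R) (u w x : V -> 'rV[R]_3).

Lemma Ck_on_conn_form k (S : set V) : open S ->
  Ck_on k S u -> Ck_on k S w -> Ck_on k S x ->
  (forall z, S z -> (chart a @` dom a) (x z)) ->
  Ck_on k S (fun z => conn_form (u z) (w z) (x z)).
Proof.
move=> oS Cu Cw Cx xa.
apply: Ck_on_sum => // i; apply: Ck_on_sum => // j.
apply: (@Ck_onZ _ _ R k S (fun z => u z 0 i * w z 0 j)
  (fun z => mval_chart h a (Z (e i)) (Z (e j)) (x z))) => //.
  apply: (@Ck_onZ _ _ R k S (fun z => u z 0 i) (fun z => w z 0 j)) => //;
    exact: Ck_on_coord.
apply: (Ck_on_comp oS (@chart_open _ _ a) xa Cx).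
by apply: (@smooth_mval_chart _ _ h); exact: smooth_conn_chart_xi.
Qed.

Lemma is_derive_coord (f : V -> 'rV[R]_3) z d i : differentiable f z ->
  is_derive z d (fun y => f y 0 i) ('D_d f z 0 i).
Proof.
move=> df; have dr : derivable f z d by exact: diff_derivable.
apply: DeriveDef; first by have /derivable_mxP := dr; apply.
by rewrite derive_mx// mxE.
Qed.

(** The motion of u and w contributes by bilinearity, that of the base point x by metric
    compatibility. In the last two terms u and w are frozen at z, so every second derivative of the
    map sits in the first two. *)
Lemma derive_conn_form z d p : dom a p -> x z = chart a p ->
  differentiable u z -> differentiable w z -> differentiable x z ->
  'D_d (fun y => conn_form (u y) (w y) (x y)) z =
  h p (Z ('D_d u z) p) (Z (w z) p) + h p (Z (u z) p) (Z ('D_d w z) p) +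
  (h p (conn_chart D a ('D_d x z) (Z (u z)) p) (Z (w z) p) +
   h p (Z (u z) p) (conn_chart D a ('D_d x z) (Z (w z)) p)).
Proof.
move=> ap xz du dw dx.
pose H i j y := mval_chart h a (Z (e i)) (Z (e j)) y.
have dH i j : differentiable (H i j) (x z).
  by rewrite xz; apply: (@smooth_mval_chart _ _ h a _ _ (smooth_conn_chart_xi _) (smooth_conn_chart_xi _) 1).1; exists p.
pose H' i j := h p (conn_chart D a ('D_d x z) (Z (e i)) p) (Z (e j) p) +
               h p (Z (e i) p) (conn_chart D a ('D_d x z) (Z (e j)) p).
have dHx i j : is_derive z d (fun y => H i j (x y)) (H' i j).
  have dc := differentiable_comp dx (dH i j).
  apply: DeriveDef; first exact: diff_derivable.
  apply: etrans (deriveE _ dc) _.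
  apply: etrans (diff_comp_app _ erefl dx (dH i j)) _.
  rewrite -(deriveE _ dx) -(deriveE _ (dH i j)) xz.
  by apply: (derive_mval_chart hLC) => //; exact: smooth_conn_chart_xi.
pose F i j y := u y 0 i * w y 0 j * H i j (x y).
pose F' i j := ('D_d u z) 0 i * w z 0 j * H i j (x z) + u z 0 i * ('D_d w z) 0 j * H i j (x z)
  + u z 0 i * w z 0 j * H' i j.
have dF i j : is_derive z d (F i j) (F' i j).
  apply: (is_derive_eq (is_deriveM (is_deriveM (is_derive_coord d i du)
    (is_derive_coord d j dw)) (dHx i j))).
  by rewrite /F' mulrfctE /GRing.scale /=; ring.
have -> : 'D_d (fun y => conn_form (u y) (w y) (x y)) z = \sum_(i < 3) \sum_(j < 3) F' i j.
  have dS : is_derive z d (\sum_(i < 3) (\sum_(j < 3) F i j)) (\sum_(i < 3) \sum_(j < 3) F' i j).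
    by apply: is_derive_sum => i; apply: is_derive_sum => j.
  have [_ <-] := dS; congr ('D_ _ _ _); apply/funext => y.
  by rewrite fct_sumE; apply: eq_bigr => i _; rewrite fct_sumE.
rewrite !conn_chart_conn_sum// !(conn_chart_xi_sum _ ap) !mval_sum_sum -!big_split /=.
apply: eq_bigr => i _; rewrite -!big_split /=; apply: eq_bigr => j _.
rewrite /F' /H' /H xz mval_chartE// -/(Z _); ring.
Qed.

End OnMap.
End ConnForm.

(** * Partial derivatives and sums of fields along a curve *)

Section Partial.
Variables (R : realType) (W : normedModType R) (f : R * R -> W) (t s : R).

Lemma derive1_snd : derive1 (fun s => f (t, s)) s = 'D_((0, 1) : R * R) f (t, s).
Proof.
have E : (fun h : R => h^-1 *: (f (t, h + s) - f (t, s))) =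
    (fun h => h^-1 *: ((f \o shift ((t, s) : R * R)) (h *: ((0, 1) : R * R)) - f (t, s))).
  apply/funext => h; congr (_ *: (f _ - _)).
  by congr pair; rewrite /= ?[_ *: 0]mulr0 ?add0r ?[_ *: 1]mulr1.
by rewrite /derive1 E.
Qed.

Lemma derive1_fst : derive1 (fun t => f (t, s)) t = 'D_((1, 0) : R * R) f (t, s).
Proof.
have E : (fun h : R => h^-1 *: (f (h + t, s) - f (t, s))) =
    (fun h => h^-1 *: ((f \o shift ((t, s) : R * R)) (h *: ((1, 0) : R * R)) - f (t, s))).
  apply/funext => h; congr (_ *: (f _ - _)).
  by congr pair; rewrite /= ?[_ *: 0]mulr0 ?add0r ?[_ *: 1]mulr1.
by rewrite /derive1 E.
Qed.

Lemma differentiable_pair_snd : differentiable (fun s : R => (t, s) : R * R) s.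
Proof. exact: differentiable_pair. Qed.

Lemma differentiable_pair_fst : differentiable (fun t : R => (t, s) : R * R) t.
Proof. exact: differentiable_pair. Qed.

Lemma differentiable_snd_arg : differentiable f (t, s) -> differentiable (fun s => f (t, s)) s.
Proof. by move=> df; exact: (differentiable_comp differentiable_pair_snd df). Qed.

Lemma differentiable_fst_arg : differentiable f (t, s) -> differentiable (fun t => f (t, s)) t.
Proof. by move=> df; exact: (differentiable_comp differentiable_pair_fst df). Qed.

End Partial.

Section CovAlongSum.
Variables (R : realType) (M : manifold3 R) (h : metric M)
  (D : M -> 'rV[R]_3 -> (M -> 'rV[R]_3) -> 'rV[R]_3) (gam : R -> M) (t : R).

(** Differentiability of the sum is carried through the same induction because additivity of
    [cov_along] requires it at each step. *)
Lemma cov_along_sum n (f : 'I_n -> R -> R) (V : 'I_n -> R -> 'rV[R]_3) :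
  (forall i, differentiable (f i) t) ->
  (forall i, differentiable (fun s => tcoord (chart_at (gam t)) (gam s) (V i s)) t) ->
  differentiable (fun s => tcoord (chart_at (gam t)) (gam s) (\sum_(i < n) f i s *: V i s)) t /\
  cov_along D gam (fun s => \sum_(i < n) f i s *: V i s) t =
  \sum_(i < n) (derive1 (f i) t *: V i t + f i t *: cov_along D gam (V i) t).
Proof.
elim: n f V => [|n IH] f V df dV.
  have e0 : (fun s => tcoord (chart_at (gam t)) (gam s) (\sum_(i < 0) f i s *: V i s)) = cst 0.
    by apply/funext => s; rewrite big_ord0 /tcoord linear0.
  rewrite e0; split; first exact: differentiable_cst.
  rewrite /cov_along e0 !big_ord0 derive1_cst add0r big1// => i _.
  by rewrite mxE scale0r.
pose w := widen_ord (leqnSn n).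
have [dS cS] := IH (fun i => f (w i)) (fun i => V (w i)) (fun i => df _) (fun i => dV _).
have e1 : (fun s => \sum_(i < n.+1) f i s *: V i s) =
    (fun s => (\sum_(i < n) f (w i) s *: V (w i) s) + f ord_max s *: V ord_max s).
  by apply/funext => s; rewrite big_ord_recr.
have dm := differentiable_tcoord_scale (df ord_max) (dV ord_max).
have e2 : (fun s => tcoord (chart_at (gam t)) (gam s) (\sum_(i < n.+1) f i s *: V i s)) =
  (fun s => tcoord (chart_at (gam t)) (gam s)
     ((\sum_(i < n) f (w i) s *: V (w i) s) + f ord_max s *: V ord_max s)).
  by apply/funext => s; rewrite big_ord_recr.
rewrite e2 e1; split; first exact: differentiable_tcoord_add.
by rewrite (cov_alongD D dS dm) cS (cov_alongZ D (df ord_max) (dV ord_max)) big_ord_recr.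
Qed.

Lemma differentiable_tcoord_vf U X : open U -> U (gam t) -> smooth_vf U X ->
  {for t, continuous gam} -> differentiable (chart (chart_at (gam t)) \o gam) t ->
  differentiable (fun s => tcoord (chart_at (gam t)) (gam s) (X (gam s))) t.
Proof.
move=> oU Ug CX cg dg; set a := chart_at (gam t) in dg *.
have ap : dom a (gam t) := dom_chart_at _.
have dL : differentiable (local_field a X) (chart a (gam t)).
  by apply: (CX a 1).1; exists (gam t).
have nE : \forall s \near t, (local_field a X \o (chart a \o gam)) s = tcoord a (gam s) (X (gam s)).
  apply: filterS (near_dom cg ap) => s as_.
  by rewrite /comp /local_field (chartK as_).
exact: near_eq_differentiable nE (differentiable_comp dg dL).
Qed.

End CovAlongSum.

(** In the application v = D_s xi and w = D_t xi; A and A' are the derivatives of xi along the two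
    mixed second derivatives of the coordinates of the variation; B - B' is the curvature term, and
    C + E is D_s D_s xi. *)
Lemma first_variation_algebra (R : realType) (M : manifold3 R) (h : metric M) (p : M)
    (A A' B B' C E v w : 'rV[R]_3) (e f : R) :
  e = h p A v + h p v A + (h p B v + h p v B) ->
  f = h p A' v + h p w C + (h p B' v + h p w E) -> A' = A ->
  2^-1 * e = f - h p w (C + E) + h p (B - B') v.
Proof.
move=> -> -> ->; rewrite mvalBl mvalDr (Defs.metric_sym h p v A) (Defs.metric_sym h p v B).
by field.
Qed.

Lemma smooth_map_dom_open (R : realType) (M : manifold3 R) (V : normedModType R)
    (S : set V) (F : V -> M) (a : atlas M) :
  open S -> smooth_map S F -> open (S `&` F @^-1` dom a).
Proof.
move=> oS CF; rewrite openE => z [Sz az]; rewrite /interior.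
apply: filterI; first exact: open_nbhs_nbhs.
by apply: near_dom az; exact: CF.1.
Qed.

(** * Pointwise first variation of the energy density *)

Section TwoParameter.
Variables (R : realType) (M : manifold3 R) (h : metric M)
  (D : M -> 'rV[R]_3 -> (M -> 'rV[R]_3) -> 'rV[R]_3).
Hypothesis hLC : levi_civita h D.
Variables (xi : M -> 'rV[R]_3) (hxi : smooth_vf setT xi).
Variables (S : set (R * R)) (oS : open S) (Phi : R -> R -> M).
Hypothesis CPhi : smooth_map S (fun z => Phi z.1 z.2).
Implicit Types (t s : R) (a : atlas M).

Let F (z : R * R) := Phi z.1 z.2.
Let d1 : R * R := (1, 0).
Let d2 : R * R := (0, 1).

Definition conn_snd t s := D (Phi t s) (velocity (Phi t) s) xi.
Definition conn_fst t s := D (Phi t s) (velocity (Phi^~ s) t) xi.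

Lemma open_preimage_dom a : open (S `&` F @^-1` dom a).
Proof. exact: (@smooth_map_dom_open _ _ _ S F a oS CPhi). Qed.

Lemma continuous_Phi_snd t s : S (t, s) -> {for s, continuous (Phi t)}.
Proof.
move=> Sts.
have c1 := differentiable_continuous (differentiable_pair_snd t s).
exact: (continuous_comp c1 (CPhi.1 _ Sts)).
Qed.

Lemma continuous_Phi_fst t s : S (t, s) -> {for t, continuous (Phi^~ s)}.
Proof.
move=> Sts.
have c1 := differentiable_continuous (differentiable_pair_fst t s).
exact: (continuous_comp c1 (CPhi.1 _ Sts)).
Qed.

Section InChart.
Variable a : atlas M.
Let y := chart a \o F.
Let Sa := S `&` F @^-1` dom a.

Lemma velocity_snd t s : S (t, s) -> dom a (Phi t s) ->
  velocity (Phi t) s = chart_field a ('D_d2 y (t, s)) (Phi t s).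
Proof.
move=> Sts aP; have dy : differentiable y (t, s) by apply: (CPhi.2 a 1).1.
rewrite (velocity_chart (continuous_Phi_snd Sts) aP (differentiable_snd_arg dy)).
have e : derive1 (chart a \o Phi t) s = 'D_d2 y (t, s) := derive1_snd y t s.
by rewrite e.
Qed.

Lemma velocity_fst t s : S (t, s) -> dom a (Phi t s) ->
  velocity (Phi^~ s) t = chart_field a ('D_d1 y (t, s)) (Phi t s).
Proof.
move=> Sts aP; have dy : differentiable y (t, s) by apply: (CPhi.2 a 1).1.
rewrite (velocity_chart (continuous_Phi_fst Sts) aP (differentiable_fst_arg dy)).
have e : derive1 (chart a \o Phi^~ s) t = 'D_d1 y (t, s) := derive1_fst y t s.
by rewrite e.
Qed.

Lemma conn_snd_chart t s : S (t, s) -> dom a (Phi t s) ->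
  conn_snd t s = conn_chart D a ('D_d2 y (t, s)) xi (Phi t s).
Proof. by move=> Sts aP; rewrite /conn_snd velocity_snd. Qed.

Lemma conn_fst_chart t s : S (t, s) -> dom a (Phi t s) ->
  conn_fst t s = conn_chart D a ('D_d1 y (t, s)) xi (Phi t s).
Proof. by move=> Sts aP; rewrite /conn_fst velocity_fst. Qed.

Lemma conn_form_snd z : Sa z ->
  conn_form h D xi a ('D_d2 y z) ('D_d2 y z) (y z) =
  h (F z) (conn_snd z.1 z.2) (conn_snd z.1 z.2).
Proof.
case: z => t s [Sz az]; rewrite (conn_formE hLC hxi _ _ az).
by rewrite -[RHS]/(h (F (t, s)) (conn_snd t s) (conn_snd t s)) (conn_snd_chart Sz az).
Qed.

Lemma conn_form_fst z : Sa z ->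
  conn_form h D xi a ('D_d1 y z) ('D_d2 y z) (y z) =
  h (F z) (conn_fst z.1 z.2) (conn_snd z.1 z.2).
Proof.
case: z => t s [Sz az]; rewrite (conn_formE hLC hxi _ _ az).
by rewrite -[RHS]/(h (F (t, s)) (conn_fst t s) (conn_snd t s)) (conn_snd_chart Sz az)
  (conn_fst_chart Sz az).
Qed.

End InChart.

Definition energy_density (z : R * R) := h (F z) (conn_snd z.1 z.2) (conn_snd z.1 z.2).
Definition boundary_term (z : R * R) := h (F z) (conn_fst z.1 z.2) (conn_snd z.1 z.2).

(** In the chart at each point the density is [conn_form] evaluated on a first partial derivative of
    the coordinates of [Phi]; one order of differentiability is spent on that derivative. *)
Lemma smooth_energy_density : smooth_on S energy_density.
Proof.
move=> k; apply: Ck_on_pt => z Sz; pose a := chart_at (F z).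
have az : dom a (F z) := dom_chart_at _.
have [Cy Dy] := CPhi.2 a k.+1.
apply: (@Ck_on_sub _ _ _ _ (S `&` F @^-1` dom a)); first by move=> _ ->.
apply: (Ck_on_eq (@open_preimage_dom a) (@conn_form_snd a)).
apply: (Ck_on_conn_form hLC hxi (@open_preimage_dom a) (Dy d2) (Dy d2) (CPhi.2 a k)).
by move=> z' [_ az']; exists (F z').
Qed.

Lemma smooth_boundary_term : smooth_on S boundary_term.
Proof.
move=> k; apply: Ck_on_pt => z Sz; pose a := chart_at (F z).
have az : dom a (F z) := dom_chart_at _.
have [Cy Dy] := CPhi.2 a k.+1.
apply: (@Ck_on_sub _ _ _ _ (S `&` F @^-1` dom a)); first by move=> _ ->.
apply: (Ck_on_eq (@open_preimage_dom a) (@conn_form_fst a)).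
apply: (Ck_on_conn_form hLC hxi (@open_preimage_dom a) (Dy d1) (Dy d2) (CPhi.2 a k)).
by move=> z' [_ az']; exists (F z').
Qed.

(** The curvature formula is available only for constant-component fields, which xi is not. Skewness
    moves xi into the slot paired by the metric, where only its value at p counts and may be
    replaced by a constant-component field. *)
Lemma curv_xi c a u v z p : constant_curvature h D c -> dom a p ->
  h p (curv D a u v xi p) (chart_field a z p) =
  c * (h p (chart_field a v p) (xi p) * h p (chart_field a u p) (chart_field a z p) -
       h p (chart_field a u p) (xi p) * h p (chart_field a v p) (chart_field a z p)).
Proof.
move=> hc ap.
rewrite (curv_skew hLC u v ap (smooth_dom_xi hxi a) (smooth_vf_chart_field a z)).
rewrite Defs.metric_sym -(tcoordK (xi p) ap) (constant_curvature_chart hLC _ _ _ _ hc ap).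
ring.
Qed.

(** D_s xi is expanded in the fields D_(e i) xi of the chart, with the components of the
    s-derivative of the coordinates as coefficients. The Leibniz rule differentiates the
    coefficients in the first term and the fields in the second. *)
Lemma cov_along_conn_snd t s : S (t, s) -> let a := chart_at (Phi t s) in
  let y := chart a \o F in
  cov_along D (Phi t) (conn_snd t) s =
  conn_chart D a ('D_d2 ('D_d2 y) (t, s)) xi (Phi t s) +
  conn_chart D a ('D_d2 y (t, s)) (conn_chart D a ('D_d2 y (t, s)) xi) (Phi t s).
Proof.
move=> Sts a y; set p := Phi t s.
have ap : dom a p := dom_chart_at _.
have Cy := CPhi.2 a.
have dy : differentiable y (t, s) by apply: (Cy 1).1.
have dy2 : differentiable ('D_d2 y) (t, s) by apply: ((Cy 2).2 d2).1.
pose e (i : 'I_3) : 'rV[R]_3 := delta_mx 0 i.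
pose f (i : 'I_3) (s' : R) : R := 'D_d2 y (t, s') 0 i.
pose V i s' := conn_chart D a (e i) xi (Phi t s').
have cP := continuous_Phi_snd Sts.
have nS : \forall s' \near s, S (t, s') /\ dom a (Phi t s').
  have c1 := differentiable_continuous (differentiable_pair_snd t s).
  apply: (c1 (S `&` F @^-1` dom a)).
  by apply: open_nbhs_nbhs; split; [exact: open_preimage_dom|].
have nE : {near s, conn_snd t =1 fun s' => \sum_(i < 3) f i s' *: V i s'}.
  apply: filterS nS => s' [Ss' as'].
  by rewrite (conn_snd_chart Ss' as') (conn_chart_xi_sum hLC hxi _ as').
rewrite (cov_along_eq D (Phi t) nE).
have df i : differentiable (f i) s.
  have dc := differentiable_snd_arg dy2.
  apply/derivable1_diffP; have /derivable1_diffP/derivable_mxP dm := dc.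
  exact: (dm 0 i).
have dgam : differentiable (chart a \o Phi t) s := differentiable_snd_arg dy.
have oa := dom_open a.
have dV i : differentiable (fun s' => tcoord (chart_at (Phi t s)) (Phi t s') (V i s')) s.
  exact: (differentiable_tcoord_vf oa ap (smooth_conn_chart_xi hLC hxi a (e i)) cP dgam).
have [_ ->] := cov_along_sum D df dV.
rewrite big_split /= (conn_chart_xi_sum hLC hxi _ ap) (conn_chart_conn_sum hLC hxi _ _ ap).
congr (_ + _); apply: eq_bigr => i _; congr (_ *: _).
  rewrite -(derive1_coord i (differentiable_snd_arg dy2)).
  exact: (congr1 (fun r : 'rV[R]_3 => r 0 i) (derive1_snd ('D_d2 y) t s)).
rewrite (cov_along_vf hLC oa ap (smooth_conn_chart_xi hLC hxi a (e i)) cP dgam).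
by rewrite (velocity_snd Sts ap).
Qed.

Lemma first_variation_pointwise c t s : constant_curvature h D c -> S (t, s) ->
  2^-1 * 'D_d1 energy_density (t, s) =
  'D_d2 boundary_term (t, s)
  - h (Phi t s) (conn_fst t s) (cov_along D (Phi t) (conn_snd t) s)
  + c * (h (Phi t s) (velocity (Phi t) s) (xi (Phi t s)) *
         h (Phi t s) (velocity (Phi^~ s) t) (conn_snd t s) -
         h (Phi t s) (velocity (Phi^~ s) t) (xi (Phi t s)) *
         h (Phi t s) (velocity (Phi t) s) (conn_snd t s)).
Proof.
move=> hc Sts; pose a := chart_at (Phi t s); pose p := Phi t s.
have ap : dom a p := dom_chart_at _.
pose y := chart a \o F.
have Cy := CPhi.2 a.
have Sa : (S `&` F @^-1` dom a) (t, s) by [].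
have oSa := @open_preimage_dom a.
have dy : differentiable y (t, s) by apply: (Cy 1).1.
have dyd d : differentiable ('D_d y) (t, s) by apply: ((Cy 2).2 d).1.
have nS : \forall z \near (t, s), (S `&` F @^-1` dom a) z by exact: open_nbhs_nbhs.
have yz : y (t, s) = chart a p by [].
have e1 : 'D_d1 energy_density (t, s) =
    'D_d1 (fun z => conn_form h D xi a ('D_d2 y z) ('D_d2 y z) (y z)) (t, s).
  by apply: near_eq_derive; apply: filterS nS => z Sz; rewrite conn_form_snd.
have e2 : 'D_d2 boundary_term (t, s) =
    'D_d2 (fun z => conn_form h D xi a ('D_d1 y z) ('D_d2 y z) (y z)) (t, s).
  by apply: near_eq_derive; apply: filterS nS => z Sz; rewrite conn_form_fst.
have E1 := etrans e1 (derive_conn_form hLC hxi d1 ap yz (dyd d2) (dyd d2) dy).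
have E2 := etrans e2 (derive_conn_form hLC hxi d2 ap yz (dyd d1) (dyd d2) dy).
have A12 := congr1 (fun z => conn_chart D a z xi p) (schwarz d2 d1 oSa (Cy 2) Sa).
have E3 := cov_along_conn_snd Sts.
have Ew := conn_fst_chart Sts ap; have Ev := conn_snd_chart Sts ap.
have Vv := velocity_snd Sts ap; have Vw := velocity_fst Sts ap.
(* The vector Zv is extended by the field with the same components in a, so that [curv_xi]
   applies. *)
have E4 v w Zv : c * (h p (chart_field a v p) (xi p) * h p (chart_field a w p) Zv -
       h p (chart_field a w p) (xi p) * h p (chart_field a v p) Zv) = h p (curv D a w v xi p) Zv.
  by have := curv_xi w v (tcoord a p Zv) hc ap; rewrite (tcoordK Zv ap) => <-.
rewrite E3 Vv Vw E4 Ew Ev.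
exact: (first_variation_algebra E1 E2 A12).
Qed.

End TwoParameter.

(** * The first variation formula *)

Section RealIntegrals.
Variable R : realType.
Notation mu := (@lebesgue_measure R).
Implicit Types (a b : R) (f F : R -> R).

Lemma within_segment_continuous a b f : (forall s, a <= s <= b -> {for s, continuous f}) ->
  {within `[a, b], continuous f}.
Proof.
by move=> cf; apply: continuous_in_subspaceT => s; rewrite inE /= in_itv /= => /cf.
Qed.

Lemma segment_integrable a b f : (forall s, a <= s <= b -> {for s, continuous f}) ->
  mu.-integrable `[a, b] (EFin \o f).
Proof.
move=> cf; apply: continuous_compact_integrable; first exact: segment_compact.
exact: within_segment_continuous.
Qed.

Lemma Rintegral_derivative a b f F : a < b ->
  (forall s, a <= s <= b -> is_derive s 1 F (f s)) ->
  (forall s, a <= s <= b -> {for s, continuous f}) ->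
  \int[mu]_(s in `[a, b]) f s = F b - F a.
Proof.
move=> ab dF cf.
have cF s : a <= s <= b -> {for s, continuous F}.
  move=> sab; apply: differentiable_continuous; apply/derivable1_diffP.
  by case: (dF s sab).
rewrite /Rintegral (@continuous_FTC2 _ f F a b ab)//.
- exact: within_segment_continuous.
- split.
  + move=> s; rewrite in_itv /= => /andP[/ltW as_ /ltW sb].
    by case: (dF s); rewrite ?as_ ?sb.
  + by apply: cvg_at_right_filter; apply: cF; rewrite lexx ltW.
  + by apply: cvg_at_left_filter; apply: cF; rewrite lexx ltW.
- move=> s; rewrite in_itv /= => /andP[/ltW as_ /ltW sb].
  by rewrite derive1E; case: (dF s); rewrite ?as_ ?sb.
Qed.

Lemma eq_RintegralB a b (f g G : R -> R) (k : R) :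
  (forall s, a <= s <= b -> {for s, continuous f}) ->
  (forall s, a <= s <= b -> {for s, continuous g}) ->
  (forall s, a <= s <= b -> G s = f s - k * g s) ->
  \int[mu]_(s in `[a, b]) G s =
  (\int[mu]_(s in `[a, b]) f s) - k * (\int[mu]_(s in `[a, b]) g s).
Proof.
move=> cf cg GE.
have ig := segment_integrable cg.
have ikg : mu.-integrable `[a, b] (EFin \o (fun s => k * g s)).
  apply: segment_integrable => s sab.
  by apply: (@continuousM _ _ (cst k) g); [exact: cst_continuous|exact: cg].
have jf := segment_integrable cf.
rewrite -RintegralZl// -RintegralB//.
by apply: eq_Rintegral => s; rewrite inE /= in_itv /= => /GE.
Qed.

Lemma is_derive_Rintegral (S : set (R * R)) (e : R * R -> R) a b eps : open S ->
  a < b -> 0 < eps -> (forall t s, - eps < t < eps -> a <= s <= b -> S (t, s)) ->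
  Ck_on 1 S e ->
  is_derive (0 : R) 1 (fun t => \int[mu]_(s in `[a, b]) e (t, s))
    (\int[mu]_(s in `[a, b]) 'D_((1, 0) : R * R) e (0, s)).
Proof.
move=> oS ab eps0 Sab Ce.
pose e1 := 'D_((1, 0) : R * R) e.
have ce1 z : S z -> {for z, continuous e1} by move=> Sz; exact: Ce.2.
have de z : S z -> differentiable e z by move=> Sz; exact: Ce.1.
have eps2 : 0 < eps / 2 by rewrite divr_gt0.
have small t : - (eps / 2) <= t <= eps / 2 -> - eps < t < eps.
  by move=> /andP[t1 t2]; apply/andP; split; lra.
(* Halving eps makes this rectangle a compact subset of S; the maximum of the t-derivative on it is
   the dominating constant for differentiation under the integral. *)
pose K : set (R * R) := `[- (eps / 2), eps / 2] `*` `[a, b].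
have KS z : K z -> S z.
  by case: z => t s [/=]; rewrite !in_itv /= => /small t1 s1; exact: Sab.
have [|||[t0 s0] _ Kmax] := @compact_EVT_max _ R (fun z => `|e1 z|) K.
- exists (0, a); split; rewrite /= in_itv /=; last by rewrite lexx ltW.
  by rewrite oppr_le0 !ltW.
- by apply: compact_setX; exact: segment_compact.
- apply: continuous_in_subspaceT => z; rewrite inE => /KS /ce1 ce.
  by apply: continuous_comp; [exact: ce|exact: norm_continuous].
set C := `|e1 (t0, s0)| in Kmax.
have mB : measurable (`[a, b]%classic : set R) by exact: measurable_itv.
pose f (t s : R) := e (t, s).
have Iz : `] - (eps / 2), eps / 2[%classic (0 : R).
  by rewrite /= in_itv /= oppr_lt0 eps2.
have intf t : `] - (eps / 2), eps / 2[%classic t -> mu.-integrable `[a, b] (EFin \o f t).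
  rewrite /= in_itv /= => /andP[/ltW t1 /ltW t2].
  apply: segment_integrable => s sab; apply: differentiable_continuous.
  apply: differentiable_snd_arg; apply: de; apply: Sab => //.
  by apply: small; rewrite t1.
have derf t s : `] - (eps / 2), eps / 2[%classic t -> `[a, b]%classic s ->
    derivable (f ^~ s) t 1.
  rewrite /= !in_itv /= => /andP[/ltW t1 /ltW t2] sab; apply/derivable1_diffP.
  by apply: (@differentiable_fst_arg _ _ e); apply: de; apply: Sab => //; apply: small; rewrite t1.
have intC : mu.-integrable `[a, b] (EFin \o cst C).
  by apply: segment_integrable => s _; exact: cst_continuous.
have ub t s : `] - (eps / 2), eps / 2[%classic t -> `[a, b]%classic s ->
    `|partial1of2 f t s| <= cst C s.
  move=> It Is; rewrite /partial1of2 (@derive1_fst _ _ e).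
  apply: Kmax; rewrite inE; split => //=.
  by move: It; rewrite /= !in_itv /= => /andP[/ltW -> /ltW ->].
have C0 (s : R) : 0 <= cst C s by rewrite /C.
have := @derivable_under_integral R _ _ mu f `[a, b] mB 0 _ _ Iz intf derf (cst C) C0 intC ub.
have := @differentiation_under_integral R _ _ mu f `[a, b] mB 0 _ _ Iz intf derf (cst C) C0 intC ub.
rewrite derive1E => dE dd.
apply: DeriveDef; first exact: dd.
rewrite [LHS]dE; apply: eq_Rintegral => s _.
by rewrite /partial1of2 (@derive1_fst _ _ e).
Qed.

End RealIntegrals.

Section FirstVariation.
Variables (R : realType) (M : manifold3 R) (h : metric M)
  (D : M -> 'rV[R]_3 -> (M -> 'rV[R]_3) -> 'rV[R]_3).
Notation mu := (@lebesgue_measure R).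
Implicit Types (gam : R -> M) (I : set R).

Lemma near_eq_velocity gam gam' t : {near t, gam =1 gam'} -> velocity gam t = velocity gam' t.
Proof.
move=> gg; have e : gam t = gam' t by exact: (nbhs_singleton gg).
rewrite /velocity -e; apply: near_eq_derive1.
by apply: filterS gg => s /= ->.
Qed.

Lemma near_eq_cov_along gam gam' (V V' : R -> 'rV[R]_3) t : {near t, gam =1 gam'} ->
  {near t, V =1 V'} -> cov_along D gam V t = cov_along D gam' V' t.
Proof.
move=> gg VV; rewrite (cov_along_eq D gam VV).
have e : gam t = gam' t by exact: (nbhs_singleton gg).
have ev := near_eq_velocity gg.
rewrite /cov_along -e -ev.
have E : derive1 (fun s => tcoord (chart_at (gam t)) (gam s) (V' s)) t =
         derive1 (fun s => tcoord (chart_at (gam t)) (gam' s) (V' s)) t.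
  by apply: near_eq_derive1; apply: filterS gg => s ->.
exact: (congr1 (fun z => z + _) E).
Qed.

Hypothesis hLC : levi_civita h D.
Variables (xi : M -> 'rV[R]_3) (hxi : smooth_vf setT xi) (c : R)
  (hc : constant_curvature h D c).
Variables (I : set R) (oI : open I) (gam : R -> M).

Definition conn_vel s := D (gam s) (velocity gam s) xi.

(* The first variation of the xi-energy is the integral of the value of
   - euler_form on the variation field. *)
Definition euler_form s v :=
  h (gam s) (D (gam s) v xi) (cov_along D gam conn_vel s)
  - c * (h (gam s) (velocity gam s) (xi (gam s)) * h (gam s) v (conn_vel s) -
         h (gam s) v (xi (gam s)) * h (gam s) (velocity gam s) (conn_vel s)).

Lemma open_variation_domain eps : open [set z : R * R | (- eps < z.1 < eps) /\ I z.2].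
Proof.
rewrite (_ : mkset _ = `] - eps, eps[%classic `*` I).
  have -> : `] - eps, eps[%classic `*` I =
      [set z : R * R | `] - eps, eps[%classic z.1] `&` [set z | I z.2] by [].
  apply: openI.
    by apply: (open_comp (f := fst)); [move=> z _; exact: cvg_fst|exact: interval_open].
  by apply: (open_comp (f := snd)) => // z _; exact: cvg_snd.
by apply/seteqP; split => z; rewrite /= in_itv.
Qed.

Section Variation.
Variables (a b eps : R) (Phi : R -> R -> M).
Hypotheses (ab : a < b) (abI : `[a, b]%classic `<=` I) (eps0 : 0 < eps)
  (HPhi : smooth_variation I gam a b eps Phi).

Let S := [set z : R * R | (- eps < z.1 < eps) /\ I z.2].
Let oS : open S := @open_variation_domain eps.
Let CPhi : smooth_map S (fun z => Phi z.1 z.2) := variation_smooth HPhi.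
Let d1 : R * R := (1, 0).
Let d2 : R * R := (0, 1).
Let e := energy_density h D xi Phi.
Let bt := boundary_term h D xi Phi.

Let S0 s : I s -> S (0, s).
Proof. by move=> Is; split => //=; rewrite oppr_lt0 eps0. Qed.

Let Iab s : a <= s <= b -> I s.
Proof. by move=> sab; apply: abI; rewrite /= in_itv. Qed.

Definition variation_field s := velocity (Phi^~ s) 0.

Lemma variation_field_eq0 s : I s -> s \notin `]a, b[ -> variation_field s = 0.
Proof.
move=> Is sab; rewrite /variation_field.
have near0 : {near (0 : R), Phi^~ s =1 fun=> Phi 0 s}.
  have : \forall t \near (0 : R), t \in `] - eps, eps[.
    by apply: near_in_itvoo; rewrite in_itv /= oppr_lt0 eps0.
  apply: filterS => t; rewrite in_itv /= => teps.
  rewrite (variation_support HPhi teps Is sab) (variation_start HPhi Is).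
  by [].
by rewrite (near_eq_velocity near0) /velocity; exact: derive1_cst.
Qed.

Lemma xi_energyE t : - eps < t < eps ->
  xi_energy h D xi (Phi t) a b = 2^-1 * \int[mu]_(s in `[a, b]) e (t, s).
Proof.
move=> teps; rewrite /xi_energy; congr (_ * _); apply: eq_Rintegral => s.
rewrite inE /= in_itv /= => sab; have Sts : S (t, s) by split => //; exact: Iab.
have dg : differentiable (chart (chart_at (Phi t s)) \o Phi t) s.
  apply: (@differentiable_snd_arg _ _ (chart (chart_at (Phi t s)) \o (fun z => Phi z.1 z.2))).
  by apply: (CPhi.2 _ 1).1; split => //; exact: dom_chart_at.
rewrite (cov_along_vf hLC openT _ hxi (continuous_Phi_snd CPhi Sts) dg)//.
Qed.

Lemma euler_form_variation s : I s ->
  'D_d2 bt (0, s) - 2^-1 * 'D_d1 e (0, s) = euler_form s (variation_field s).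
Proof.
move=> Is; rewrite (first_variation_pointwise hLC hxi oS CPhi hc (S0 Is)).
have nI : \forall s' \near s, I s' by exact: open_nbhs_nbhs.
have n0 : {near s, Phi 0 =1 gam}.
  by apply: filterS nI => s' Is'; rewrite (variation_start HPhi Is').
have P0 := variation_start HPhi Is.
have v0 := near_eq_velocity n0.
have nV : {near s, conn_snd D xi Phi 0 =1 conn_vel}.
  apply: filterS nI => s' Is'; rewrite /conn_snd /conn_vel (variation_start HPhi Is').
  congr (D _ _ _); apply: near_eq_velocity.
  have : \forall s'' \near s', I s'' by exact: open_nbhs_nbhs.
  by apply: filterS => s'' Is''; rewrite (variation_start HPhi Is'').
have cv := near_eq_cov_along n0 nV.
have c0 : conn_snd D xi Phi 0 s = conn_vel s by exact: (nbhs_singleton nV).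
rewrite cv c0 /euler_form /conn_fst -/(variation_field s) v0 P0; ring.
Qed.

(** Continuity is read off from [euler_form_variation], whose left side is built from first
    derivatives of functions smooth on S. It is thus obtained for variation fields. *)
Lemma euler_form_continuous s : I s ->
  {for s, continuous (fun s => euler_form s (variation_field s))}.
Proof.
move=> Is.
have nI : \forall s' \near s, I s' by exact: open_nbhs_nbhs.
have nE : {near s, (fun s => 'D_d2 bt (0, s) - 2^-1 * 'D_d1 e (0, s)) =1
                   (fun s => euler_form s (variation_field s))}.
  by apply: filterS nI => s' Is'; rewrite euler_form_variation.
have c1 := differentiable_continuous (differentiable_pair_snd 0 s).
have cb : {for (0, s), continuous ('D_d2 bt)}.
  by apply: ((smooth_boundary_term hLC hxi oS CPhi 1).2 d2); exact: S0.
have ce : {for (0, s), continuous ('D_d1 e)}.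
  by apply: ((smooth_energy_density hLC hxi oS CPhi 1).2 d1); exact: S0.
have cc : {for s, continuous (fun s => 'D_d2 bt (0, s) - 2^-1 * 'D_d1 e (0, s))}.
  apply: continuousB; first exact: (continuous_comp c1 cb).
  apply: (@continuousM _ _ (cst 2^-1) (fun s => 'D_d1 e (0, s))); first exact: cst_continuous.
  exact: (continuous_comp c1 ce).
rewrite /prop_for /continuous_at -(nbhs_singleton nE).
by apply: cvg_trans cc; exact: near_eq_cvg.
Qed.

Lemma first_variation : is_derive (0 : R) 1 (fun t => xi_energy h D xi (Phi t) a b)
  (- (\int[mu]_(s in `[a, b]) euler_form s (variation_field s))).
Proof.
have Ce := smooth_energy_density hLC hxi oS CPhi 1.
have Cb := smooth_boundary_term hLC hxi oS CPhi 1.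
have dI : is_derive (0 : R) 1 (fun t => \int[mu]_(s in `[a, b]) e (t, s))
    (\int[mu]_(s in `[a, b]) 'D_d1 e (0, s)).
  apply: (is_derive_Rintegral oS ab eps0 _ Ce) => t s teps sab.
  by split => //; exact: Iab.
have c1 (s : R) := differentiable_continuous (differentiable_pair_snd (0 : R) s).
have cb s : a <= s <= b -> {for s, continuous (fun s => 'D_d2 bt (0, s))}.
  by move=> /Iab/S0 Ss; exact: (continuous_comp (c1 s) (Cb.2 d2 _ Ss)).
have ce s : a <= s <= b -> {for s, continuous (fun s => 'D_d1 e (0, s))}.
  by move=> /Iab/S0 Ss; exact: (continuous_comp (c1 s) (Ce.2 d1 _ Ss)).
have bt0 s : I s -> s \notin `]a, b[ -> bt (0, s) = 0.
  move=> Is sab; rewrite /bt /boundary_term /= /conn_fst -/(variation_field s).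
  by rewrite variation_field_eq0// (conn0 hLC openT (Logic.I : setT (Phi 0 s)) hxi) mval0l.
have intb : \int[mu]_(s in `[a, b]) 'D_d2 bt (0, s) = 0.
  rewrite (@Rintegral_derivative R a b _ (fun s => bt (0, s)) ab _ cb).
    rewrite !bt0 ?subrr//; try by apply: Iab; rewrite lexx ltW.
      by rewrite in_itv /= ltxx.
    by rewrite in_itv /= ltxx andbF.
  move=> s sab; have db : differentiable bt (0, s) by apply: Cb.1; apply: S0; exact: Iab.
  apply: DeriveDef; last by rewrite -derive1E derive1_snd.
  by apply/derivable1_diffP; exact: differentiable_snd_arg.
have -> : - (\int[mu]_(s in `[a, b]) euler_form s (variation_field s)) =
    2^-1 * \int[mu]_(s in `[a, b]) 'D_d1 e (0, s).
  have aux (x y z : R) : x = y - z -> y = 0 -> - x = z.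
    by move=> -> ->; rewrite sub0r opprK.
  have E := eq_RintegralB cb ce (fun s sab => esym (euler_form_variation (Iab sab))).
  exact: aux E intb.
(* The variation is controlled only for |t| < eps, so the energy is replaced by the integral of [e]
   near 0 only. *)
apply: (@near_eq_is_derive _ _ _ (fun t => 2^-1 * \int[mu]_(s in `[a, b]) e (t, s))).
  have : \forall t \near (0 : R), t \in `] - eps, eps[.
    by apply: near_in_itvoo; rewrite in_itv /= oppr_lt0 eps0.
  by apply: filterS => t; rewrite in_itv /= => teps; rewrite xi_energyE.
Qed.

End Variation.
End FirstVariation.

(** * Variations in the direction of a bump field *)

(** By continuity f exceeds f s0 / 2 on a segment of positive length around s0, and the integral
    over that segment bounds the whole from below. *)
Lemma Rintegral_segment_gt0 (R : realType) (a b s0 : R) (f : R -> R) : a < s0 < b ->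
  (forall s, a <= s <= b -> {for s, continuous f}) ->
  (forall s, a <= s <= b -> 0 <= f s) -> 0 < f s0 ->
  0 < \int[@lebesgue_measure R]_(s in `[a, b]) f s.
Proof.
move=> /andP[as0 s0b] cf f0 fs0.
have m0 : 0 < f s0 / 2 by rewrite divr_gt0.
have cs0 : {for s0, continuous f} by apply: cf; rewrite !ltW.
have [d d0 dA] : exists2 d : R, 0 < d & forall s, ball s0 d s ->
    [/\ `]a, b[%classic s, `|f s0 - f s| < f s0 / 2 & `|f s0 - f s| < f s0 / 2].
  by apply: open_continuous_ball => //=; rewrite in_itv /= as0.
pose u := s0 - d / 2; pose v := s0 + d / 2.
have uv : u < v by rewrite /u /v; lra.
have inb s : u <= s <= v -> [/\ a <= s <= b & f s0 / 2 <= f s].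
  move=> /andP[us sv].
  have /dA[] : ball s0 d s.
    by rewrite -ball_normE /= ltr_norml; apply/andP; split; rewrite /u /v in us sv; lra.
  rewrite /= in_itv /= => /andP[/ltW as_ /ltW sb] + _; rewrite ltr_norml => /andP[_ fs].
  by rewrite as_ sb; split => //; lra.
have mAB (x y : R) : measurable (`[x, y]%classic : set R) by exact: measurable_itv.
have if_ := segment_integrable cf.
have if1 : (@lebesgue_measure R).-integrable `[u, v] (EFin \o f).
  by apply: segment_integrable => s /inb[sab _]; exact: cf.
have ic : (@lebesgue_measure R).-integrable `[u, v] (EFin \o cst (f s0 / 2)).
  by apply: segment_integrable => s _; exact: cst_continuous.
have c0 : 0 < \int[@lebesgue_measure R]_(s in `[u, v]) cst (f s0 / 2) s.
  have muE : fine (@lebesgue_measure R `[u, v]%classic) = v - u.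
    by rewrite lebesgue_measure_itv /= lte_fin uv.
  have := @Rintegral_cst _ _ _ (@lebesgue_measure R) _ (mAB u v) (f s0 / 2).
  by rewrite muE => ->; rewrite mulr_gt0// subr_gt0.
apply: (lt_le_trans c0).
apply: (@le_trans _ _ (\int[@lebesgue_measure R]_(s in `[u, v]) f s)).
  by apply: le_Rintegral => // s; rewrite /= in_itv /= => /inb[].
rewrite /Rintegral fine_le ?integrable_fin_num//.
apply: ge0_subset_integral => //.
- by case/integrableP : if_.
- by move=> s; rewrite /= !in_itv /= => /inb[].
Qed.

Section SmoothMaps.
Variables (R : realType) (M : manifold3 R) (V : normedModType R).

(** Gluing criterion, for variations that are defined by cases. *)
Lemma smooth_map_local (S : set V) (F : V -> M) :
  (forall z, S z -> exists T G, [/\ open T, T z, smooth_map T G &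
     forall z', T z' -> G z' = F z']) -> smooth_map S F.
Proof.
move=> loc; split.
  move=> z /loc[T [G [oT Tz [cG _] GF]]].
  have nE : \forall z' \near z, G z' = F z'.
    by have : nbhs z T by [exact: open_nbhs_nbhs]; apply: filterS.
  rewrite /prop_for /continuous_at -(GF z Tz).
  by apply: cvg_trans (cG z Tz); exact: near_eq_cvg.
move=> b k; apply: Ck_on_pt => z [Sz bz]; have [T [G [oT Tz CG GF]]] := loc z Sz.
apply: (@Ck_on_sub _ _ _ _ (T `&` G @^-1` dom b)).
  by move=> _ ->; split => //=; rewrite GF.
apply: (@Ck_on_eq _ _ _ k _ (chart b \o G) (chart b \o F)
  (smooth_map_dom_open b oT CG) _ (CG.2 b k)).
by move=> z' [Tz' _] /=; rewrite GF.
Qed.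

Lemma smooth_map_chart_inv (a : atlas M) (T : set V) (Y : V -> 'rV[R]_3) :
  open T -> smooth_on T Y ->
  (forall z, T z -> (chart a @` dom a) (Y z)) -> smooth_map T (chart_inv a \o Y).
Proof.
move=> oT CY YO.
have cY : forall z, T z -> {for z, continuous (chart_inv a \o Y)}.
  move=> z Tz; have [p ap pY] := YO z Tz.
  have c1 : {for z, continuous Y} by exact: (CY 0).
  have c2 : {for Y z, continuous (chart_inv a)}.
    by rewrite -pY; exact: chart_inv_continuous.
  exact: continuous_comp c1 c2.
split => // b k.
have oTb : open (T `&` (chart_inv a \o Y) @^-1` dom b).
  rewrite openE => z [Tz bz]; rewrite /interior.
  apply: filterI; first exact: open_nbhs_nbhs.
  by apply: near_dom bz; exact: cY.
apply: (@Ck_on_comp _ _ _ _ k _ (chart a @` (dom a `&` dom b)) (chart b \o chart_inv a) Y) => //.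
- exact: trans_open.
- move=> z [Tz bz]; have [p ap pY] := YO z Tz; exists p => //; split => //.
  by move: bz; rewrite /= -pY chartK.
- by apply: Ck_on_sub (CY k) => z [].
- exact: transition_smooth.
Qed.

End SmoothMaps.

Lemma linear_fst_continuous (R : realType) : continuous (fst : R * R -> R).
Proof. by move=> z; exact: cvg_fst. Qed.

Lemma linear_snd_continuous (R : realType) : continuous (snd : R * R -> R).
Proof. by move=> z; exact: cvg_snd. Qed.

Lemma Ck_on_fst (R : realType) k (S : set (R * R)) : open S ->
  Ck_on k S (fst : R * R -> R).
Proof.
exact: (@Ck_on_lin R _ _ k S (fst : {linear (R * R)%type -> R}) (@linear_fst_continuous R)).
Qed.

Lemma smooth_map_snd (R : realType) (M : manifold3 R) (J : set R) (gam : R -> M) :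
  open J -> smooth_map J gam ->
  smooth_map [set z : R * R | J z.2] (fun z => gam z.2).
Proof.
move=> oJ Cg; split.
  move=> z Jz; apply: continuous_comp; first exact: linear_snd_continuous.
  exact: Cg.1.
move=> a k; have oJa := smooth_map_dom_open a oJ Cg.
exact: (Ck_on_linr (@linear_snd_continuous R) oJa (Cg.2 a k)).
Qed.

Section BumpVariation.
Variables (R : realType) (M : manifold3 R) (I : set R) (oI : open I) (gam : R -> M).
Hypothesis Cgam : smooth_map I gam.

(** The variation adds t phi(s) u to the coordinates of gam s. The radius r is fixed before phi and
    its support, so that several bumps can be used with the same chart neighbourhood. *)
Lemma bump_variation s0 (u : 'rV[R]_3) : I s0 -> let a := chart_at (gam s0) in
  exists2 r : R, 0 < r & (forall s, `|s - s0| < r -> I s /\ dom a (gam s)) /\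
  forall (phi : R -> R) a' b', smooth_on setT phi -> (forall s, `|phi s| <= 1) ->
    s0 - r < a' -> b' < s0 + r ->
    (forall s, s \notin `]a', b'[ -> phi s = 0) ->
    exists eps Phi, [/\ 0 < eps, smooth_variation I gam a' b' eps Phi &
      forall s, `|s - s0| < r -> variation_field Phi s = phi s *: chart_field a u (gam s)].
Proof.
move=> Is0 a.
have ap : dom a (gam s0) := dom_chart_at _.
pose y := chart a \o gam; pose y0 := y s0.
have Oy0 : (chart a @` dom a) y0 by exists (gam s0).
have oIa := smooth_map_dom_open a oI Cgam.
have nO : nbhs y0 (chart a @` dom a).
  by apply: open_nbhs_nbhs; split => //; exact: chart_open.
have [rho /= rho0 rhoO] := (nbhs_ballP _ _).1 nO.
have cy : {for s0, continuous y} by apply: (Cgam.2 a 0); split.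
have nIa : nbhs s0 (I `&` gam @^-1` dom a) by apply: open_nbhs_nbhs.
have rho2 : 0 < rho / 2 by rewrite divr_gt0.
have ny : nbhs s0 [set s | `|y0 - y s| < rho / 2].
  exact: ((cvgrPdist_lt _ _).1 cy _ rho2).
have [r /= r0 rP] := (nbhs_ballP _ _).1 (filterI nIa ny).
have rB s : `|s - s0| < r -> [/\ I s, dom a (gam s) & `|y0 - y s| < rho / 2].
  move=> sr; have sb : ball s0 r s by rewrite -ball_normE /= distrC.
  by have [[Is as_] yb] := rP s sb; split.
exists r => //; split; first by move=> s /rB[].
move=> phi a' b' Cphi phi1 ra rb phi0.
(* The margin rho is split in halves: r keeps the curve within rho / 2 of y0, and the displacement
   is at most eps (1 + |u|) = rho / 2. The 1 covers u = 0. *)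
pose eps := rho / 2 / (1 + `|u|).
have u1 : 0 < 1 + `|u| by rewrite ltr_pwDl.
have eps0 : 0 < eps by rewrite divr_gt0.
pose Y (z : R * R) := y z.2 + (z.1 * phi z.2) *: u.
pose J := [set s : R | `|s - s0| < r].
have oJ : open J.
  rewrite (_ : J = ball s0 r); first exact: ball_open.
  by apply/seteqP; split => s; rewrite -ball_normE /= distrC.
have YO z : - eps < z.1 < eps -> J z.2 -> (chart a @` dom a) (Y z).
  case: z => t s /= teps /rB[Is as_ yb]; apply: rhoO; rewrite -ball_normE /= /Y /=.
  rewrite opprD addrA (le_lt_trans (ler_normB _ _))// [rho]splitr.
  rewrite ltr_leD// normrZ normrM.
  have t1 : `|t| <= eps by rewrite ler_norml; case/andP: teps => /ltW -> /ltW ->.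
  apply: (@le_trans _ _ (eps * (1 + `|u|))).
    apply: ler_pM; rewrite ?mulr_ge0 ?lerDr//.
    by rewrite -[leRHS]mulr1 ler_pM.
  by rewrite /eps divfK// gt_eqF.
(* The chart formula is meaningful only for s in J. Elsewhere the curve is left fixed, and on J the
   two definitions agree wherever phi vanishes. *)
pose Phi t s : M := if `[< J s >] then chart_inv a (Y (t, s)) else gam s.
have PhiJ t s : J s -> Phi t s = chart_inv a (Y (t, s)) by move=> Js; rewrite /Phi asboolT.
have Phi0 t s : I s -> t * phi s = 0 -> Phi t s = gam s.
  move=> Is tp; rewrite /Phi; case: asboolP => // /rB[_ as_ _].
  by rewrite /Y /= tp scale0r addr0 /y /= chartK.
pose S := [set z : R * R | (- eps < z.1 < eps) /\ I z.2].
have oSJ : open [set z : R * R | (- eps < z.1 < eps) /\ J z.2] by exact: open_variation_domain.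
exists eps, Phi; split => //.
- split.
  + apply: smooth_map_local => -[t s] [/= teps Is].
    have [Js|nJ] := pselect (J s).
      exists [set z : R * R | (- eps < z.1 < eps) /\ J z.2], (chart_inv a \o Y).
      split => //; last by move=> [t' s'] [_ Js'] /=; rewrite PhiJ.
      apply: smooth_map_chart_inv => //; last by move=> z [z1 z2]; exact: YO.
      move=> k; apply: Ck_onD => //.
        have := Ck_on_linr (@linear_snd_continuous R) oIa (Cgam.2 a k).
        by apply: Ck_on_sub => z [_ /rB[]].
      apply: Ck_onZ => //; last exact: Ck_on_cst.
      apply: (@Ck_onZ _ _ R _ _ (fst : R * R -> R) (fun z => phi z.2)) => //.
        exact: Ck_on_fst.
      have := Ck_on_linr (@linear_snd_continuous R) openT (Cphi k).
      exact: Ck_on_sub.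
    (* An open set on which phi vanishes; together with J it covers I because [a', b'] lies in J. *)
    pose J' := I `&` ~` `[a', b']%classic.
    have oJ' : open J' by apply: openI => //; apply: closed_openC; exact: interval_closed.
    exists [set z : R * R | J' z.2], (fun z => gam z.2); split => //=.
    * by apply: (open_comp (f := snd)) => // z _; exact: linear_snd_continuous.
    * split => //=; rewrite in_itv /= => /andP[as_ sb]; apply: nJ.
      by rewrite /J /= ltr_norml; apply/andP; split; lra.
    * apply: smooth_map_snd => //.
      split; first by move=> x [Ix _]; exact: Cgam.1.
      by move=> b k; apply: Ck_on_sub (Cgam.2 b k) => x [[]].
    * move=> [t' s'] [/= Is' ns']; rewrite Phi0// phi0 ?mulr0//.
      apply/negP => sab; apply: ns'; exact: subset_itv_oo_cc sab.
  + by move=> s Is; rewrite Phi0// mul0r.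
  + by move=> t s _ Is sab; rewrite Phi0// phi0// mulr0.
move=> s Js; have [Is as_ _] := rB s Js.
rewrite /variation_field.
have P0 : Phi 0 s = gam s by rewrite Phi0// mul0r.
have aP : dom a (Phi 0 s) by rewrite P0.
have PE : Phi^~ s = chart_inv a \o (fun t => y s + (t * phi s) *: u).
  by apply/funext => t; rewrite PhiJ.
have nE : {near (0 : R), (fun t => y s + t *: (phi s *: u)) =1 chart a \o Phi^~ s}.
  have : \forall t \near (0 : R), t \in `] - eps, eps[.
    by apply: near_in_itvoo; rewrite in_itv /= oppr_lt0 eps0.
  apply: filterS => t; rewrite in_itv /= => teps.
  have [q aq qY] := YO (t, s) teps Js.
  by rewrite PhiJ// -qY chartK// qY /Y /= scalerA.
have did : differentiable (id : 'rV[R]_3 -> 'rV[R]_3) (y s + 0 *: (phi s *: u)).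
  exact: ex_diff.
have [dl dlE] := is_derive_line did.
have dc : derivable (chart a \o Phi^~ s) 0 1 by exact: near_eq_derivable nE dl.
have dcd : differentiable (chart a \o Phi^~ s) 0 by exact/derivable1_diffP.
have cP : {for (0 : R), continuous (Phi^~ s)}.
  rewrite PE; apply: continuous_comp.
    apply: differentiable_continuous.
    have := (derivable1_diffP _ _).1 dl; congr (differentiable _ _).
    by apply/funext => t; rewrite scalerA.
  rewrite mul0r scale0r addr0; exact: chart_inv_continuous.
rewrite (velocity_chart cP aP dcd) P0.
have -> : derive1 (chart a \o Phi^~ s) 0 = phi s *: u.
  rewrite -(near_eq_derive1 nE) derive1E dlE diff_val//.
exact: linearZ.
Qed.

End BumpVariation.

(** * The Euler equation of the xi-energy *)

Section EulerEquation.
Variables (R : realType) (M : manifold3 R) (h : metric M)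
  (D : M -> 'rV[R]_3 -> (M -> 'rV[R]_3) -> 'rV[R]_3).
Hypothesis hLC : levi_civita h D.
Variables (xi : M -> 'rV[R]_3) (hxi : smooth_vf setT xi) (c : R)
  (hc : constant_curvature h D c).
Variables (I : set R) (oI : open I) (gam : R -> M) (Cgam : smooth_map I gam).
Notation mu := (@lebesgue_measure R).
Notation euler := (euler_form h D xi c gam).

Lemma euler_formP s x u v : euler s (x *: u + v) = x * euler s u + euler s v.
Proof.
have hD := lc_connection hLC.
rewrite /euler_form (conn_linear hD openT (Logic.I : setT (gam s)) hxi).
rewrite !mvalDl !mvalZl; ring.
Qed.

Lemma euler_formZ s x u : euler s (x *: u) = x * euler s u.
Proof.
have e0 : euler s 0 = 0.
  have := euler_formP s 1 0 0; rewrite scale1r addr0 mul1r => /eqP.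
  by rewrite -subr_eq subrr => /eqP.
by rewrite -[x *: u]addr0 euler_formP e0 addr0.
Qed.

(** If g s0 > 0, a positive first variation is wanted, but continuity of g is not at hand. A first
    bump makes bump times g the Euler form of a variation field, hence continuous and positive near
    s0. A second bump supported in that neighbourhood then has a positive integral against g,
    contradicting parallelism. *)
Lemma parallel_euler_le0 s0 u : generalized_xi_parallel h D xi I gam -> I s0 ->
  euler s0 (chart_field (chart_at (gam s0)) u (gam s0)) <= 0.
Proof.
move=> par Is0; set a := chart_at (gam s0); rewrite leNgt; apply/negP.
pose g s := euler s (chart_field a u (gam s)); rewrite -/(g s0) => g0.
have [r r0 [rI rvar]] := bump_variation oI Cgam u Is0.
have vary d : 0 < d < r ->
  [/\ s0 - d < s0 < s0 + d, `[s0 - d, s0 + d]%classic `<=` I &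
  exists eps Phi, [/\ 0 < eps, smooth_variation I gam (s0 - d) (s0 + d) eps Phi &
   forall s, `|s - s0| < r ->
     euler s (variation_field Phi s) = bump (s0 - d) (s0 + d) s * g s]].
  move=> /andP[d0 dr]; split; first by apply/andP; split; lra.
    move=> s; rewrite /= in_itv /= => /andP[s1 s2].
    by have [] := rI s; rewrite // ltr_norml; apply/andP; split; lra.
  have [||||eps [Phi [eps0 HPhi PhiE]]] :=
    rvar (bump (s0 - d) (s0 + d)) (s0 - d) (s0 + d) (@smooth_bump _ _ _).
  - by move=> s; rewrite ger0_norm ?bump_ge0// bump_le1.
  - lra.
  - lra.
  - by move=> s; rewrite in_itv /= => /bump_eq0.
  by exists eps, Phi; split => // s sr; rewrite PhiE// euler_formZ.
clearbody g.
have r2 : 0 < r / 2 < r by apply/andP; split; lra.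
have [s0d sI [eps1 [Phi1 [eps10 HPhi1 E1]]]] := vary _ r2.
have s00 : `|s0 - s0| < r by rewrite subrr normr0.
pose G1 (s : R) : R := euler s (variation_field Phi1 s).
have c1 : {for s0, continuous G1} := euler_form_continuous hLC hxi hc oI eps10 HPhi1 Is0.
have {}E1 s : `|s - s0| < r -> G1 s = bump (s0 - r / 2) (s0 + r / 2) s * g s by exact: E1.
clearbody G1.
have G10 : 0 < G1 s0 by rewrite (E1 _ s00) mulr_gt0// bump_gt0.
have nG : nbhs s0 [set s | 0 < G1 s].
  by apply: (c1 [set x | 0 < x]); exact: (lt_nbhsr G10).
have [d /= d0 dG] := (nbhs_ballP _ _).1 nG.
(* Small enough for the second bump to live where G1 > 0 and inside the chart neighbourhood. *)
pose e := Num.min d r / 2.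
have m0 : 0 < Num.min d r by rewrite lt_min d0.
have md : Num.min d r <= d by rewrite ge_min lexx.
have mr : Num.min d r <= r by rewrite ge_min lexx orbT.
have er : 0 < e < r by rewrite /e; apply/andP; split; lra.
have ed : e < d by rewrite /e; lra.
have [s0e eI [eps2 [Phi2 [eps20 HPhi2 E2]]]] := vary _ er.
have inr s : s0 - e <= s <= s0 + e -> `|s - s0| < d /\ `|s - s0| < r.
  by move=> /andP[s1 s2]; move: er => /andP[_ er]; rewrite !ltr_norml;
    split; apply/andP; split; lra.
have ge0 s : s0 - e <= s <= s0 + e -> 0 <= euler s (variation_field Phi2 s).
  move=> /inr[sd sr]; rewrite (E2 s sr); apply: mulr_ge0; first exact: bump_ge0.
  have : 0 < G1 s by apply: dG; rewrite -ball_normE /= distrC.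
  rewrite (E1 s sr) => p0; rewrite leNgt; apply/negP => gs.
  have := mulr_ge0_le0 (bump_ge0 (s0 - r / 2) (s0 + r / 2) s) (ltW gs).
  by rewrite leNgt p0.
have e2 : s0 - e < s0 + e by move: s0e => /andP[]; exact: lt_trans.
have [_ dE] := first_variation hLC hxi hc oI e2 eI eps20 HPhi2.
have [_ dE'] := par _ _ _ _ e2 eI eps20 HPhi2.
have : 0 < \int[mu]_(s in `[s0 - e, s0 + e]) euler s (variation_field Phi2 s).
  apply: (@Rintegral_segment_gt0 _ _ _ s0) => //.
    move=> s sab; apply: (euler_form_continuous hLC hxi hc oI eps20 HPhi2).
    by apply: eI; rewrite /= in_itv.
  by rewrite (E2 s0 s00) mulr_gt0// bump_gt0.
by rewrite -oppr_lt0 -dE dE' ltxx.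
Qed.

(** The one-sided bound applied to v and -v gives the equation by linearity; the converse is the
    first variation formula with a vanishing integrand. *)
Lemma parallel_euler : generalized_xi_parallel h D xi I gam <->
  forall s, I s -> forall v, euler s v = 0.
Proof.
split=> [par s Is v|e0 a b eps Phi ab abI eps0 HPhi].
  (* In the chart [chart_at (gam s)] a constant-component field has its components as value at gam
     s, so every tangent vector w is reached. *)
  have le0 w : euler s w <= 0.
    by have := parallel_euler_le0 w par Is; rewrite chart_field_at.
  apply/eqP; rewrite eq_le le0 /=.
  by have := le0 (- v); rewrite -scaleN1r euler_formZ mulN1r oppr_le0.
have [d1 d2] := first_variation hLC hxi hc oI ab abI eps0 HPhi.
apply: DeriveDef; first exact: d1.
rewrite d2 (@eq_Rintegral _ _ _ mu _ (cst 0)); last first.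
  by move=> s /set_mem /abI Is; rewrite e0.
by rewrite Rintegral_cst// mul0r oppr0.
Qed.

End EulerEquation.

(** * Differentiability of fields along the curve *)

Section AlongCurve.
Variables (R : realType) (M : manifold3 R) (h : metric M)
  (D : M -> 'rV[R]_3 -> (M -> 'rV[R]_3) -> 'rV[R]_3).
Hypothesis hLC : levi_civita h D.
Variables (I : set R) (oI : open I) (gam : R -> M) (Cgam : smooth_map I gam).

Lemma differentiable_chart_curve t a : I t -> dom a (gam t) -> differentiable (chart a \o gam) t.
Proof. by move=> It at_; apply: (Cgam.2 a 1).1. Qed.

(** [metric_smooth] concerns fields on open sets of M; expanding V and V' in coordinate fields
    reduces to metric coefficients composed with the curve. *)
Lemma differentiable_mval_along a (V V' : R -> 'rV[R]_3) t : I t -> dom a (gam t) ->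
  differentiable (fun s => tcoord a (gam s) (V s)) t ->
  differentiable (fun s => tcoord a (gam s) (V' s)) t ->
  differentiable (fun s => h (gam s) (V s) (V' s)) t.
Proof.
move=> It at_ dV dV'; have dy := differentiable_chart_curve It at_.
pose E i := chart_field a (delta_mx 0 i : 'rV[R]_3).
pose F (i j : 'I_3) (s : R) : R := tcoord a (gam s) (V s) 0 i * tcoord a (gam s) (V' s) 0 j *
  mval_chart h a (E i) (E j) (chart a (gam s)).
have nE : \forall s \near t, (\sum_(i < 3) \sum_(j < 3) F i j) s = h (gam s) (V s) (V' s).
  apply: filterS (near_dom (Cgam.1 t It) at_) => s as_.
  rewrite -[in RHS](tcoordK (V s) as_) -[in RHS](tcoordK (V' s) as_).
  rewrite [in RHS]chart_field_sum [X in h _ _ X]chart_field_sum mval_sum_sum fct_sumE.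
  apply: eq_bigr => i _; rewrite fct_sumE; apply: eq_bigr => j _.
  by rewrite /F mval_chartE.
apply: (near_eq_differentiable nE); apply: differentiable_sum => i.
apply: differentiable_sum => j.
have cd (f : R -> 'rV[R]_3) l : differentiable f t -> differentiable (fun s => f s 0 l) t.
  by move=> /derivable1_diffP/derivable_mxP/(_ 0 l) df; apply/derivable1_diffP.
have dG : differentiable (mval_chart h a (E i) (E j)) ((chart a \o gam) t).
  have CE := @smooth_vf_chart_field _ _ a.
  by apply: (@smooth_mval_chart _ _ h a _ _ (CE _) (CE _) 1).1; exists (gam t).
apply: differentiableM; last exact: (differentiable_comp dy dG).
by apply: differentiableM; exact: cd.
Qed.

Lemma differentiable_tcoord_along V a t : smooth_along I gam V -> I t -> dom a (gam t) ->
  differentiable (fun s => tcoord a (gam s) (V s)) t.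
Proof. by move=> CV It at_; apply: (CV a 1).1. Qed.

Lemma differentiable_conn_vel (xi : M -> 'rV[R]_3) t : smooth_vf setT xi -> I t ->
  differentiable (fun s => tcoord (chart_at (gam t)) (gam s) (conn_vel D xi gam s)) t.
Proof.
move=> hxi It; set a := chart_at (gam t); have at_ : dom a (gam t) := dom_chart_at _.
pose y := chart a \o gam; have Cy := Cgam.2 a.
have dy2 : differentiable (derive1 y) t.
  have -> : derive1 y = 'D_1 y by apply/funext => s; exact: derive1E.
  by apply: ((Cy 2).2 1).1.
pose e (i : 'I_3) : 'rV[R]_3 := delta_mx 0 i.
pose f (i : 'I_3) (s : R) : R := derive1 y s 0 i.
pose V i s := conn_chart D a (e i) xi (gam s).
have df i : differentiable (f i) t.
  apply/derivable1_diffP; have /derivable1_diffP/derivable_mxP dm := dy2.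
  exact: (dm 0 i).
have dV i : differentiable (fun s => tcoord a (gam s) (V i s)) t.
  exact: (differentiable_tcoord_vf (dom_open a) at_
    (smooth_conn_chart_xi hLC hxi a (e i)) (Cgam.1 t It)
    (differentiable_chart_curve It at_)).
have [dS _] := cov_along_sum D df dV.
apply: near_eq_differentiable dS.
have : \forall s \near t, (I `&` gam @^-1` dom a) s.
  by apply: open_nbhs_nbhs; split => //; exact: smooth_map_dom_open.
apply: filterS => s [Is as_]; congr tcoord.
rewrite /conn_vel (velocity_chart (Cgam.1 s Is) as_ (differentiable_chart_curve Is as_)).
by rewrite -/(conn_chart D a _ xi (gam s)) (conn_chart_xi_sum hLC hxi _ as_).
Qed.

End AlongCurve.

(** * The Euler equation in the Frenet frame *)

Section Frame.
Variables (R : realType) (M : manifold3 R) (h : metric M) (p : M) (T N B : 'rV[R]_3).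
Hypotheses (hu : [/\ h p T T = 1, h p N N = 1 & h p B B = 1])
  (ho : [/\ h p T N = 0, h p T B = 0 & h p N B = 0]).

Lemma frame_coords (x y z : R) : let v := x *: T + y *: N + z *: B in
  [/\ h p v T = x, h p v N = y & h p v B = z].
Proof.
case: hu => hT hN hB; case: ho => hTN hTB hNB; rewrite /= !mvalDl !mvalZl.
rewrite hT hN hB hTN hTB hNB (Defs.metric_sym h p N T) (Defs.metric_sym h p B T).
rewrite (Defs.metric_sym h p B N) hTN hTB hNB.
by split; ring.
Qed.

Lemma frame_mval (x y z x' y' z' : R) :
  h p (x *: T + y *: N + z *: B) (x' *: T + y' *: N + z' *: B) = x * x' + y * y' + z * z'.
Proof.
have [e1 e2 e3] := frame_coords x y z.
by rewrite !mvalDr !mvalZr e1 e2 e3; ring.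
Qed.

End Frame.

(** The positive product forces a nonzero determinant; the coordinates of x are the entries of x
    times the inverse of the frame matrix. *)
Lemma frame_span (R : realType) (u v w : 'rV[R]_3) (o : R) : 0 < o * \det (frame_mx u v w) ->
  forall x, exists a b c : R, x = a *: u + b *: v + c *: w.
Proof.
move=> od x; have dF : \det (frame_mx u v w) \is a GRing.unit.
  by rewrite unitfE; apply/eqP => d0; move: od; rewrite d0 mulr0 ltxx.
pose y := x *m invmx (frame_mx u v w).
have -> : x = y *m frame_mx u v w by rewrite mulmxKV.
exists (y 0 0), (y 0 1), (y 0 2%:R).
rewrite mulmx_sum_row !big_ord_recr big_ord0 /= add0r /frame_mx !rowK.
congr (_ *: _ + _ *: _ + _ *: _); by [congr (y 0 _); apply: val_inj|].
Qed.

Section FrenetCurve.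
Variables (R : realType) (M : manifold3 R) (h : metric M)
  (D : M -> 'rV[R]_3 -> (M -> 'rV[R]_3) -> 'rV[R]_3) (c : R).
Hypothesis hLC : levi_civita h D.
Variables (xi : M -> 'rV[R]_3) (hxi : smooth_vf setT xi).
Variables (I : set R) (oI : open I) (iI : is_interval I).
Variables (gam : R -> M) (Cgam : smooth_map I gam) (o : R -> R).
Variables (T N B : R -> 'rV[R]_3) (k tau : R -> R).
Hypothesis hF : frenet_frame h D I gam o T N B k tau.
Variables (xi1 xi2 xi3 : R -> R).
Hypothesis hdec : forall t, I t ->
  xi (gam t) = xi1 t *: T t + xi2 t *: N t + xi3 t *: B t.

Let near_I t : I t -> \forall s \near t, I s.
Proof. by move=> It; exact: open_nbhs_nbhs. Qed.

Let comb (x y z : R -> R) t := x t *: T t + y t *: N t + z t *: B t.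

(** The components are not assumed differentiable: they are the inner products of V with an
    orthonormal frame, which are. The lemma serves twice, for xi along the curve and for its
    covariant derivative. *)
Lemma frame_components (V : R -> 'rV[R]_3) (x y z : R -> R) t :
  (forall s, I s -> differentiable (fun r => tcoord (chart_at (gam s)) (gam r) (V r)) s) ->
  (forall s, I s -> V s = comb x y z s) -> I t ->
  [/\ differentiable x t, differentiable y t, differentiable z t &
   cov_along D gam V t = comb (fun t => derive1 x t - k t * y t)
     (fun t => derive1 y t + k t * x t - tau t * z t)
     (fun t => derive1 z t + tau t * y t) t].
Proof.
move=> dV VE It; set a := chart_at (gam t).
have at_ : dom a (gam t) := dom_chart_at _.
have dT := differentiable_tcoord_along (frenet_smoothT hF) It at_.
have dN := differentiable_tcoord_along (frenet_smoothN hF) It at_.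
have dB := differentiable_tcoord_along (frenet_smoothB hF) It at_.
have coords s : I s -> [/\ h (gam s) (V s) (T s) = x s, h (gam s) (V s) (N s) = y s
    & h (gam s) (V s) (B s) = z s].
  move=> Is; rewrite (VE s Is).
  exact: frame_coords (frenet_unit hF Is) (frenet_orthogonal hF Is) _ _ _.
have dx : differentiable x t.
  apply: near_eq_differentiable (differentiable_mval_along h Cgam It at_ (dV t It) dT).
  by apply: filterS (near_I It) => s /coords[].
have dy : differentiable y t.
  apply: near_eq_differentiable (differentiable_mval_along h Cgam It at_ (dV t It) dN).
  by apply: filterS (near_I It) => s /coords[].
have dz : differentiable z t.
  apply: near_eq_differentiable (differentiable_mval_along h Cgam It at_ (dV t It) dB).
  by apply: filterS (near_I It) => s /coords[].
split => //.
have nE : {near t, V =1 (fun s => x s *: T s + y s *: N s + z s *: B s)}.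
  by apply: filterS (near_I It) => s /VE.
rewrite (cov_along_eq D gam nE).
have dxT := differentiable_tcoord_scale dx dT.
have dyN := differentiable_tcoord_scale dy dN.
have dzB := differentiable_tcoord_scale dz dB.
rewrite (cov_alongD D (differentiable_tcoord_add dxT dyN) dzB).
rewrite (cov_alongD D dxT dyN) (cov_alongZ D dx dT) (cov_alongZ D dy dN) (cov_alongZ D dz dB).
rewrite (frenet_eqT hF It) (frenet_eqN hF It) (frenet_eqB hF It) /comb.
apply/rowP => i; rewrite !mxE; ring.
Qed.

Let alpha t := derive1 xi1 t - k t * xi2 t.
Let beta t := derive1 xi2 t + k t * xi1 t - tau t * xi3 t.
Let delta t := derive1 xi3 t + tau t * xi2 t.

Lemma conn_vel_frame t : I t -> conn_vel D xi gam t = comb alpha beta delta t.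
Proof.
move=> It; have at_ := dom_chart_at (gam t).
have dg s (Is : I s) := differentiable_chart_curve Cgam Is (dom_chart_at (gam s)).
have dxi s (Is : I s) : differentiable (fun r => tcoord (chart_at (gam s)) (gam r) (xi (gam r))) s.
  exact: (differentiable_tcoord_vf openT (Logic.I : setT (gam s)) hxi (Cgam.1 s Is) (dg s Is)).
have [_ _ _ <-] := @frame_components (xi \o gam) xi1 xi2 xi3 t dxi hdec It.
by rewrite (cov_along_vf hLC openT _ hxi (Cgam.1 t It) (dg t It)).
Qed.

Lemma cov_conn_vel_frame t : I t ->
  [/\ differentiable alpha t, differentiable beta t, differentiable delta t &
   cov_along D gam (conn_vel D xi gam) t =
    comb (fun t => derive1 alpha t - k t * beta t)
     (fun t => derive1 beta t + k t * alpha t - tau t * delta t)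
     (fun t => derive1 delta t + tau t * beta t) t].
Proof.
apply: frame_components; last exact: conn_vel_frame.
by move=> s Is; exact: (differentiable_conn_vel hLC oI Cgam).
Qed.

Let speed t := alpha t ^+ 2 + beta t ^+ 2 + delta t ^+ 2.

Lemma is_derive_speed t : I t ->
  is_derive t 1 speed
    (2 * (alpha t * derive1 alpha t + beta t * derive1 beta t + delta t * derive1 delta t)).
Proof.
move=> It; have [da db dd _] := cov_conn_vel_frame It.
have sq (f : R -> R) : differentiable f t ->
    is_derive t 1 (fun s => f s ^+ 2) (2 * (f t * derive1 f t)).
  move=> df; have dfx : is_derive t 1 f (derive1 f t).
    by apply: DeriveDef; [exact: diff_derivable|rewrite derive1E].
  apply: (is_derive_eq (is_deriveM dfx dfx)); rewrite /GRing.scale /=; ring.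
apply: (is_derive_eq (is_deriveD (is_deriveD (sq _ da) (sq _ db)) (sq _ dd))); ring.
Qed.

Lemma euler_form_tangent t : I t -> euler_form h D xi c gam t (T t) =
  alpha t * derive1 alpha t + beta t * derive1 beta t + delta t * derive1 delta t.
Proof.
move=> It; have [_ _ _ cE] := cov_conn_vel_frame It.
have u := frenet_unit hF It; have or := frenet_orthogonal hF It.
rewrite /euler_form cE -(frenet_tangent hF It) subrr mulr0 subr0.
have -> : D (gam t) (T t) xi = comb alpha beta delta t.
  by rewrite -conn_vel_frame// /conn_vel (frenet_tangent hF It).
(* The terms in k and tau cancel, since the Frenet equations have a skew-symmetric matrix. *)
rewrite /comb (frame_mval u or); ring.
Qed.

(** The products of X with xi and with D_s xi are kept as parameters, so that the same formula
    serves for N and for B. *)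
Lemma euler_form_normal t (X : 'rV[R]_3) (x w : R) : I t ->
  h (gam t) X (xi (gam t)) = x -> h (gam t) X (conn_vel D xi gam t) = w ->
  euler_form h D xi c gam t X =
  (derive1 alpha t - k t * beta t) * h (gam t) (T t) (D (gam t) X xi)
  + (derive1 beta t + k t * alpha t - tau t * delta t) * h (gam t) (N t) (D (gam t) X xi)
  + (derive1 delta t + tau t * beta t) * h (gam t) (B t) (D (gam t) X xi)
  - c * (xi1 t * w - x * alpha t).
Proof.
move=> It hx hw; have [_ _ _ cE] := cov_conn_vel_frame It.
have u := frenet_unit hF It; have or := frenet_orthogonal hF It.
have [e1 _ _] := frame_coords u or (xi1 t) (xi2 t) (xi3 t).
have [e2 _ _] := frame_coords u or (alpha t) (beta t) (delta t).
rewrite /euler_form hx hw cE (Defs.metric_sym h _ (D _ _ _)) -(frenet_tangent hF It).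
rewrite (hdec It) (Defs.metric_sym h _ (T t)) e1.
rewrite (conn_vel_frame It) (Defs.metric_sym h _ (T t)) e2 /comb !mvalDl !mvalZl; ring.
Qed.

Lemma speed_constant : I !=set0 ->
  (exists C, forall t, I t -> speed t = C) <->
  (forall t, I t -> euler_form h D xi c gam t (T t) = 0).
Proof.
move=> [t0 It0]; split=> [[C sC] t It|e0].
  have [_ d1] := is_derive_speed It.
  have : 'D_1 speed t = 'D_1 (cst C) t.
    by apply: near_eq_derive; apply: filterS (near_I It) => s /sC.
  rewrite derive_cst d1 euler_form_tangent// => /eqP.
  by rewrite mulf_eq0 pnatr_eq0 /= => /eqP.
have d0 t : I t -> is_derive t 1 speed 0.
  move=> It; apply: (is_derive_eq (is_derive_speed It)).
  by rewrite -euler_form_tangent// e0// mulr0.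
have lt_eq x y : x < y -> I x -> I y -> speed x = speed y.
  move=> xy Ix Iy.
  have inI z : x <= z <= y -> I z by exact: iI.
  have dz z : z \in `]x, y[ -> is_derive z 1 speed ((fun=> 0) z).
    by rewrite in_itv /= => /andP[xz zy]; apply/d0/inI; rewrite !ltW.
  have cz : {within `[x, y], continuous speed}.
    apply: derivable_within_continuous => z; rewrite in_itv /= => /inI/d0.
    by case.
  have [z _ /eqP] := MVT xy dz cz.
  by rewrite mul0r subr_eq0 => /eqP.
exists (speed t0) => t It.
by have [/lt_eq->|/lt_eq->|->] := ltgtP t t0.
Qed.

End FrenetCurve.

Unset Implicit Arguments.
Set Strict Implicit.
Set Printing Implicit Defensive.

Theorem theorem9 (R : realType) (M : manifold3 R) (h : metric M)
    (nabla : M -> 'rV[R]_3 -> (M -> 'rV[R]_3) -> 'rV[R]_3) (c : R)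
    (hLC : levi_civita h nabla) (hc : constant_curvature h nabla c)
    (xi : M -> 'rV[R]_3) (hxi : smooth_vf setT xi) (hxi0 : exists p, xi p != 0)
    (I : set R) (hI0 : I !=set0) (hIo : open I) (hIi : is_interval I)
    (gam : R -> M) (hgam : smooth_map I gam)
    (harc : forall t, I t -> h (gam t) (velocity gam t) (velocity gam t) = 1)
    (o : R -> R) (ho : orientation_along I gam o)
    (T N B : R -> 'rV[R]_3) (k tau : R -> R)
    (hF : frenet_frame h nabla I gam o T N B k tau)
    (xi1 xi2 xi3 : R -> R)
    (hdec : forall t, I t ->
      xi (gam t) = xi1 t *: T t + xi2 t *: N t + xi3 t *: B t) :
  let sigma X Y t := h (gam t) (X t) (nabla (gam t) (Y t) xi) in
  let dxi1 := derive1 xi1 in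
  let dxi2 := derive1 xi2 in
  let dxi3 := derive1 xi3 in
  let alpha t := dxi1 t - k t * xi2 t in
  let beta t := dxi2 t + k t * xi1 t - tau t * xi3 t in
  let delta t := dxi3 t + tau t * xi2 t in
  let dalpha := derive1 alpha in
  let dbeta := derive1 beta in
  let ddelta := derive1 delta in
  generalized_xi_parallel h nabla xi I gam <->
  [/\ exists C : R, forall t, I t ->
        (dxi1 t - k t * xi2 t) ^+ 2
        + (dxi2 t + k t * xi1 t - tau t * xi3 t) ^+ 2
        + (dxi3 t + tau t * xi2 t) ^+ 2 = C,
      forall t, I t ->
        c * (dxi1 t * xi2 t - k t * xi2 t ^+ 2 - xi1 t * dxi2 t
             - k t * xi1 t ^+ 2 + tau t * xi1 t * xi3 t)
        + (dalpha t - k t * beta t) * sigma T N t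
        + (k t * alpha t + dbeta t - tau t * delta t) * sigma N N t
        + (tau t * beta t + ddelta t) * sigma B N t = 0
    & forall t, I t ->
        c * (dxi1 t * xi3 t - k t * xi2 t * xi3 t - xi1 t * dxi3 t
             - tau t * xi1 t * xi2 t)
        + (dalpha t - k t * beta t) * sigma T B t
        + (k t * alpha t + dbeta t - tau t * delta t) * sigma N B t
        + (tau t * beta t + ddelta t) * sigma B B t = 0].
Proof.
move=> sigma dxi1 dxi2 dxi3 alpha beta delta dalpha dbeta ddelta.
have speedE := speed_constant c hLC hxi hIo hIi hgam hF hdec hI0.
have eulerN t : I t -> euler_form h nabla xi c gam t (N t) =
    c * (dxi1 t * xi2 t - k t * xi2 t ^+ 2 - xi1 t * dxi2 t
         - k t * xi1 t ^+ 2 + tau t * xi1 t * xi3 t)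
    + (dalpha t - k t * beta t) * sigma T N t
    + (k t * alpha t + dbeta t - tau t * delta t) * sigma N N t
    + (tau t * beta t + ddelta t) * sigma B N t.
  move=> It; have u := frenet_unit hF It; have or := frenet_orthogonal hF It.
  have [_ e1 _] := frame_coords u or (xi1 t) (xi2 t) (xi3 t).
  have [_ e2 _] := frame_coords u or (alpha t) (beta t) (delta t).
  have hx : h (gam t) (N t) (xi (gam t)) = xi2 t.
    by rewrite (hdec t It) Defs.metric_sym e1.
  have hw : h (gam t) (N t) (conn_vel nabla xi gam t) = beta t.
    by rewrite (conn_vel_frame hLC hxi hIo hgam hF hdec It) Defs.metric_sym e2.
  have E : euler_form h nabla xi c gam t (N t) =
      (dalpha t - k t * beta t) * sigma T N t
      + (dbeta t + k t * alpha t - tau t * delta t) * sigma N N t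
      + (ddelta t + tau t * beta t) * sigma B N t
      - c * (xi1 t * beta t - xi2 t * alpha t).
    exact: (euler_form_normal c hLC hxi hIo hgam hF hdec It hx hw).
  by rewrite E /alpha /beta /delta; ring.
have eulerB t : I t -> euler_form h nabla xi c gam t (B t) =
    c * (dxi1 t * xi3 t - k t * xi2 t * xi3 t - xi1 t * dxi3 t
         - tau t * xi1 t * xi2 t)
    + (dalpha t - k t * beta t) * sigma T B t
    + (k t * alpha t + dbeta t - tau t * delta t) * sigma N B t
    + (tau t * beta t + ddelta t) * sigma B B t.
  move=> It; have u := frenet_unit hF It; have or := frenet_orthogonal hF It.
  have [_ _ e1] := frame_coords u or (xi1 t) (xi2 t) (xi3 t).
  have [_ _ e2] := frame_coords u or (alpha t) (beta t) (delta t).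
  have hx : h (gam t) (B t) (xi (gam t)) = xi3 t.
    by rewrite (hdec t It) Defs.metric_sym e1.
  have hw : h (gam t) (B t) (conn_vel nabla xi gam t) = delta t.
    by rewrite (conn_vel_frame hLC hxi hIo hgam hF hdec It) Defs.metric_sym e2.
  have E : euler_form h nabla xi c gam t (B t) =
      (dalpha t - k t * beta t) * sigma T B t
      + (dbeta t + k t * alpha t - tau t * delta t) * sigma N B t
      + (ddelta t + tau t * beta t) * sigma B B t
      - c * (xi1 t * delta t - xi3 t * alpha t).
    exact: (euler_form_normal c hLC hxi hIo hgam hF hdec It hx hw).
  by rewrite E /alpha /beta /delta; ring.
rewrite (parallel_euler hLC hxi hc hIo hgam); split=> [e0|[eT eN eB] t It v].
  split.
  - by apply/speedE => t It; exact: e0.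
  - by move=> t It; rewrite -eulerN// e0.
  - by move=> t It; rewrite -eulerB// e0.
(* The three conditions say that the linear form [euler_form] vanishes on T, N and B, which span the
   tangent space. *)
have [x [y [z ->]]] := frame_span (frenet_oriented hF It) v.
have e0T := speedE.1 eT t It.
rewrite -addrA !euler_formP // ?e0T ?euler_formZ // eulerN// eN// eulerB// eB//.
by rewrite !mulr0 !addr0.
Qed.
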